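(* There exists a constant $c>1/25$ such that for every $d\ge1$, every sequential estimator $\mathscr{E}$ on $\mathbb{R}^d$, and every $P$ with density $p\in\mathcal{Q}(\mathscr{E};c)\setminus\mathcal{L}$, the ULR process $R_t=R_t(X_1^t;\mathscr{E})$ satisfies $$P^\infty\left(\lim_{t\to\infty}R_t=\infty\right)=1 .$$ Consequently, for every $\alpha\in(0,1)$, the test which rejects when $R_t\ge1/\alpha$, with rejection time $\tau_\alpha=\inf\{t\ge1:R_t\ge1/\alpha\}$, is consistent against i.i.d. draws from any such distribution: $P^\infty(\tau_\alpha<\infty)=1$ for every $p\in\mathcal{Q}(\mathscr{E};c)\setminus\mathcal{L}$.
   Context: $X_1,X_2,\dots$ are $\mathbb{R}^d$-valued observations, $X_1^t=(X_1,\dots,X_t)$, and $P^\infty$ is the law of an i.i.d. sequence from $P$. $\mathcal{D}$ is the set of probability laws on $\mathbb{R}^d$ with a Lebesgue density; laws are identified with their densities ($p$ is the density of $P$). $\mathcal{D}_1=\{P\in\mathcal{D}:\mathbb{E}_P[\max(0,\log p(X))]<\infty,\ \mathbb{E}_P\|X\|<\infty\}$. $\mathcal{L}\subset\mathcal{D}$ is the set of laws with log-concave density ($e^g$ with $g$ concave, value $-\infty$ allowed). For $P\in\mathcal{D}_1$, the log-concave M-projection is the unique law $\mathfrak{L}_P=\operatorname{argmin}_{L\in\mathcal{L}}\mathrm{KL}(P\|L)$, with density $\mathfrak{L}_p$. $d_H$ is the Hellinger distance, $d_H(p,q)=\|\sqrt p-\sqrt q\|_{L_2(\mathbb{R}^d)}$.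 A sequential estimator is a sequence $\mathscr{E}=\{\mathscr{E}_t\}_{t\ge0}$ of (measurable) maps $\mathscr{E}_t:(\mathbb{R}^d)^t\to\mathcal{D}$; write $\hat q_t=\mathscr{E}_t(X_1,\dots,X_t)$ for the resulting density. For $t\ge d+1$, $\hat p_t$ is the log-concave maximum likelihood estimate from $X_1,\dots,X_t$, i.e. the maximiser of $\sum_{s\le t}\log f(X_s)$ over log-concave probability densities $f$ (it exists and is unique a.s. under $P^\infty$, $P\in\mathcal{D}$). The universal likelihood ratio (ULR) process is $R_t=1$ for $t\le d$ and $R_t=\prod_{d+1\le s\le t}\hat q_{s-1}(X_s)/\hat p_t(X_s)$ for $t>d$. The prediction regret is $\rho_t(\mathscr{E};p)=\sum_{s\le t}\left(\log p(X_s)-\log\hat q_{s-1}(X_s)\right)$, and for $c>0$ $$\mathcal{Q}(\mathscr{E};c)=\left\{p\in\mathcal{D}_1:\ P^\infty\left(\limsup_{t\to\infty}\frac{\rho_t(\mathscr{E};p)}{t\,d_H^2(p,\mathfrak{L}_p)}\le c\right)=1\right\}.$$ The condition is only considered here for $p\notin\mathcal{L}$, for which $d_H(p,\mathfrak{L}_p)>0$. *)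

(* Defs.v *)
From HB Require Import structures.
From mathcomp Require Import all_boot all_order all_algebra.
From mathcomp Require Import all_classical all_reals all_analysis.

Set Implicit Arguments.
Unset Strict Implicit.
Unset Printing Implicit Defensive.
Import Order.TTheory GRing.Theory Num.Def Num.Theory.
Import numFieldNormedType.Exports.

Local Open Scope classical_set_scope.
Local Open Scope ring_scope.
Local Open Scope ereal_scope.

Definition measure_matrix_display : measure_display -> measure_display.
Proof. exact. Qed.

Section measurable_matrix.
Context {disp : measure_display} {T : measurableType disp} (m n : nat).

(* For T = R this is the Borel sigma-algebra of the product topology. *)
Definition matrix_coords : set (set 'M[T]_(m, n)) :=
  \bigcup_(ij in [set: 'I_m * 'I_n])
    preimage_set_system setT (fun A : 'M[T]_(m, n) => A ij.1 ij.2) measurable.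

Let matrix_set0 : <<s matrix_coords >> set0.
Proof. exact: sigma_algebra0. Qed.

Let matrix_setC A : <<s matrix_coords >> A -> <<s matrix_coords >> (~` A).
Proof. exact: sigma_algebraC. Qed.

Let matrix_bigcup (F : (set 'M[T]_(m, n))^nat) :
  (forall i, <<s matrix_coords >> (F i)) -> <<s matrix_coords >> (\bigcup_i F i).
Proof. exact: sigma_algebra_bigcup. Qed.

HB.instance Definition _ := @isMeasurable.Build (measure_matrix_display disp)
  'M[T]_(m, n) <<s matrix_coords >> matrix_set0 matrix_setC matrix_bigcup.

End measurable_matrix.

Section measurable_matrix_theory.
Context {disp disp' : measure_display} {S : measurableType disp'}
  {T : measurableType disp} (m n : nat).

Lemma measurable_mx_entry (i : 'I_m) (j : 'I_n) :
  measurable_fun setT (fun A : 'M[T]_(m, n) => A i j).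
Proof.
move=> _ Y mY; rewrite setTI; apply: sub_sigma_algebra.
by exists (i, j) => //; exists Y => //; rewrite setTI.
Qed.

Lemma measurable_fun_mxP (f : S -> 'M[T]_(m, n)) :
  (forall i j, measurable_fun setT (fun x => f x i j)) -> measurable_fun setT f.
Proof.
move=> mf; have mE : @measurable _ 'M[T]_(m, n) = <<s @matrix_coords _ T m n >> by [].
refine (@measurability disp' _ S _ setT f _ mE _).
move=> _ [_ [[i j] _ [B mB <-]] <-].
by rewrite setTI setTI -[X in measurable X]setTI; exact: mf.
Qed.

End measurable_matrix_theory.

Section lebesgue_Rd.
Context {R : realType}.

Definition cons_rV d (xv : measurableTypeR R * 'rV[R]_d) : 'rV[R]_d.+1 :=
  row_mx (xv.1%:M : 'rV[R]_1) xv.2 : 'rV[R]_(1 + d).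

Definition uncons_rV d (x : 'rV[R]_d.+1) : measurableTypeR R * 'rV[R]_d :=
  (x ord0 ord0, \row_j x ord0 (lift ord0 j)).

Lemma cons_rV0 d xv : @cons_rV d xv ord0 ord0 = xv.1.
Proof.
rewrite /cons_rV mxE; case: splitP => // j _.
by rewrite (ord1 j) mxE eqxx.
Qed.

Lemma cons_rVS d xv j : @cons_rV d xv ord0 (lift ord0 j) = xv.2 ord0 j.
Proof.
rewrite /cons_rV mxE; case: splitP => [k /= | k /= /eqP].
  by rewrite (ord1 k).
by rewrite /bump /= add1n eqSS => /eqP jk; congr (_ _ _); apply: val_inj.
Qed.

Lemma uncons_rVK d : cancel (@uncons_rV d) (@cons_rV d).
Proof.
move=> x; apply/rowP => i; case: (unliftP ord0 i) => [j|] ->.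
  by rewrite cons_rVS mxE.
by rewrite cons_rV0.
Qed.

Lemma cons_rVK d : cancel (@cons_rV d) (@uncons_rV d).
Proof.
case=> a v; rewrite /uncons_rV cons_rV0; congr pair.
by apply/rowP => j; rewrite mxE cons_rVS.
Qed.

Lemma measurable_cons_rV d : measurable_fun setT (@cons_rV d).
Proof.
apply: measurable_fun_mxP => i j; rewrite (ord1 i).
case: (unliftP ord0 j) => [k|] ->.
  under eq_fun do rewrite cons_rVS.
  apply: (measurableT_comp (measurable_mx_entry ord0 k)).
  exact: measurable_snd.
under eq_fun do rewrite cons_rV0.
exact: measurable_fst.
Qed.

Lemma measurable_uncons_rV d : measurable_fun setT (@uncons_rV d).
Proof.
apply: measurable_fun_pair; first exact: measurable_mx_entry.
apply: measurable_fun_mxP => i j.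
under eq_fun do rewrite mxE.
exact: measurable_mx_entry.
Qed.

Section step.
Variables (d : nat) (mu : {sigma_finite_measure set 'rV[R]_d -> \bar R}).

Definition leb_step : set 'rV[R]_d.+1 -> \bar R :=
  pushforward (@lebesgue_measure R \x mu) (@cons_rV d).

Let leb_step0 : leb_step set0 = 0.
Proof. by rewrite /leb_step /pushforward preimage_set0 measure0. Qed.

Let leb_step_ge0 A : 0 <= leb_step A.
Proof. by apply: integral_ge0 => x _; exact: measure_ge0. Qed.

Let leb_step_sigma_additive : semi_sigma_additive leb_step.
Proof.
rewrite /leb_step => F mF tF mUF; rewrite /pushforward preimage_bigcup.
apply: measure_semi_sigma_additive.
- by move=> n; rewrite -[X in measurable X]setTI; exact: measurable_cons_rV.
- apply/trivIsetP => /= i j _ _ ij; rewrite -preimage_setI.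
  by move/trivIsetP : tF => /(_ _ _ _ _ ij) ->//; rewrite preimage_set0.
- rewrite -preimage_bigcup -[X in measurable X]setTI.
  exact: measurable_cons_rV.
Qed.

HB.instance Definition _ :=
  isMeasure.Build _ _ _ leb_step leb_step0 leb_step_ge0 leb_step_sigma_additive.

Let leb_step_sigma_finite : sigma_finite setT leb_step.
Proof.
have /sigma_finiteP[F [TF ndF Foo]] := sigma_finiteT (@lebesgue_measure R).
have /sigma_finiteP[G [TG ndG Goo]] := sigma_finiteT mu.
exists (fun n => @uncons_rV d @^-1` (F n `*` G n)).
  apply/esym/seteqP; split=> // x _.
  have [n _ Fn] : (\bigcup_n F n) (uncons_rV x).1 by rewrite -TF.
  have [k _ Gk] : (\bigcup_n G n) (uncons_rV x).2 by rewrite -TG.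
  exists (maxn n k) => //; split.
    by move: Fn; exact/subsetPset/ndF/leq_maxl.
  by move: Gk; exact/subsetPset/ndG/leq_maxr.
move=> k; have [mF ?] := Foo k; have [mG ?] := Goo k; split.
  rewrite -[X in measurable X]setTI; apply: measurable_uncons_rV => //.
  exact: measurableX.
rewrite /leb_step /pushforward -comp_preimage.
rewrite (_ : _ \o _ = id) ?preimage_id; last first.
  by apply/funext => x /=; rewrite cons_rVK.
by rewrite product_measure1E// lte_mul_pinfty// ge0_fin_numE.
Qed.

HB.instance Definition _ :=
  Measure_isSigmaFinite.Build _ _ _ leb_step leb_step_sigma_finite.

End step.

Fixpoint leb (d : nat) : {sigma_finite_measure set 'rV[R]_d -> \bar R} :=
  match d with
  | 0%N => \d_(0%R : 'rV[R]_0)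
  | d'.+1 => leb_step (leb d')
  end.

Lemma leb_box d (A : 'I_d -> set R) : (forall i, measurable (A i)) ->
  leb d [set x | forall i, A i (x ord0 i)] =
  \prod_(i < d) @lebesgue_measure R (A i).
Proof.
elim: d A => [|d IH] A mA.
  by rewrite big_ord0 /= diracE mem_set// => -[].
rewrite big_ord_recl -IH//=.
set B := [set x : 'rV[R]_d | forall i, A (lift ord0 i) (x ord0 i)].
have mB : measurable B.
  rewrite (_ : B = \bigcap_(i in [set: 'I_d])
      ((fun x : 'rV[R]_d => x ord0 i) @^-1` A (lift ord0 i))); last first.
    by apply/seteqP; split=> x Ax i; [move=> _|]; exact: Ax.
  apply: fin_bigcap_measurable => // i _.
  by rewrite -[X in measurable X]setTI; exact: measurable_mx_entry.
transitivity ((@lebesgue_measure R \x leb d) (A ord0 `*` B)); last first.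
  by rewrite product_measure1E//; exact: (mA ord0).
suff <- : @cons_rV d @^-1` [set x | forall i, A i (x ord0 i)] = A ord0 `*` B.
  by [].
apply/seteqP; split=> [[a v] /= Av|[a v] /= [Aa Bv] i].
  split; first by have := Av ord0; rewrite cons_rV0.
  by move=> i; have := Av (lift ord0 i); rewrite cons_rVS.
by case: (unliftP ord0 i) => [j|] ->; rewrite ?cons_rVS ?cons_rV0//; exact: Bv.
Qed.

End lebesgue_Rd.
Arguments leb R d : clear implicits.

Section densities.
Context {R : realType} (d : nat).
Implicit Types (p q f g l : 'rV[R]_d -> R) (x : 'rV[R]_d).

(** Laws in [D] are represented by their densities; a law has many densities,
    which agree almost everywhere. *)
Definition D : set ('rV[R]_d -> R) :=
  [set p : 'rV[R]_d -> R | [/\ measurable_fun setT p, (forall x, (0 <= p x)%R) &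
               \int[leb R d]_x (p x)%:E = 1]].

Definition law p (A : set 'rV[R]_d) : \bar R := \int[leb R d]_(x in A) (p x)%:E.

Definition euclidean_norm x : R := Num.sqrt (\sum_(i < d) x ord0 i ^+ 2)%R.

Definition D1 : set ('rV[R]_d -> R) :=
  [set p : 'rV[R]_d -> R | [/\ D p,
    \int[leb R d]_x ((p x)%:E * maxe 0 (lne (p x)%:E)) < +oo &
    \int[leb R d]_x ((p x)%:E * (euclidean_norm x)%:E) < +oo]].

Definition concave (g : 'rV[R]_d -> \bar R) : Prop :=
  forall x y (t : R), (0 <= t <= 1)%R ->
    t%:E * g x + (1 - t)%:E * g y <= g (t *: x + (1 - t) *: y)%R.

Definition log_concave f : Prop :=
  exists g : 'rV[R]_d -> \bar R,
    [/\ (forall x, g x < +oo), concave g & forall x, (f x)%:E = expeR (g x)].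

Definition log_concave_density : set ('rV[R]_d -> R) := D `&` log_concave.

(** The laws having a log-concave density: some version is log-concave. *)
Definition L : set ('rV[R]_d -> R) :=
  [set p : 'rV[R]_d -> R | D p /\ exists f, log_concave_density f /\
                            {ae leb R d, forall x, f x = p x}].

(** With [0 * _ = 0] and [lne 0 = -oo], the integrand is [0] where [p] vanishes
    and [+oo] where only [q] does. *)
Definition KL p q : \bar R :=
  \int[leb R d]_x ((p x)%:E * (lne (p x)%:E - lne (q x)%:E)).

Definition log_concave_projection p l : Prop :=
  L l /\ forall l', L l' -> KL p l <= KL p l'.

(** At most [sqrt 2] on [D], so [fine] loses nothing there. *)
Definition hellinger p q : R :=
  fine ('N[leb R d]_2%:E [(fun x => (Num.sqrt (p x) - Num.sqrt (q x))%:E)]).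

End densities.
Arguments D R d : clear implicits.
Arguments D1 R d : clear implicits.
Arguments L R d : clear implicits.
Arguments log_concave_density R d : clear implicits.

Section iid.
Context {R : realType} (d : nat).

Definition cylinders : set (set (nat -> 'rV[R]_d)) :=
  \bigcup_n
    preimage_set_system setT (fun x : nat -> 'rV[R]_d => x n) measurable.

(** Sample paths with the product sigma-algebra; [x s] is the observation
    numbered [s.+1]. *)
Definition sample_path : Type := g_sigma_algebraType cylinders.
HB.instance Definition _ := Measurable.on sample_path.

Definition iid_law (p : 'rV[R]_d -> R) (Pinf : probability sample_path R) :=
  forall n (A : nat -> set 'rV[R]_d), (forall i, measurable (A i)) ->
    Pinf [set x | forall i, (i < n)%N -> A i (x i)] =
    \prod_(i < n) law p (A i).

(** "[E] has probability one for an i.i.d. sequence from [p]".  The law of such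
    a sequence exists (Kolmogorov) and is unique (cylinders form a pi-system),
    so the quantification ranges over exactly one measure when [p] is in [D]. *)
Definition iid_almost_surely (p : 'rV[R]_d -> R) (E : set sample_path) : Prop :=
  forall Pinf : probability sample_path R, iid_law p Pinf ->
    {ae Pinf, forall x, E x}.

End iid.
Arguments sample_path R d : clear implicits.

Section universal_likelihood_ratio.
Context {R : realType} (d : nat).
Implicit Types (x : sample_path R d) (t : nat).

Definition sample_prefix t x : t.-tuple 'rV[R]_d := [tuple x i | i < t].

(** Measurability of [E t] is joint measurability of the density in the sample
    and in the point at which it is evaluated. *)
Definition sequential_estimator
    (E : forall t, t.-tuple 'rV[R]_d -> 'rV[R]_d -> R) : Prop :=
  forall t,
    measurable_fun setT (fun xy : t.-tuple 'rV[R]_d * 'rV[R]_d => E t xy.1 xy.2)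
    /\ forall xs, D R d (E t xs).

Definition log_likelihood t (f : 'rV[R]_d -> R) (xs : t.-tuple 'rV[R]_d) :
    \bar R :=
  \sum_(s < t) lne (f (tnth xs s))%:E.

Definition is_mle t (xs : t.-tuple 'rV[R]_d) (f : 'rV[R]_d -> R) : Prop :=
  log_concave_density R d f /\
  forall g, log_concave_density R d g ->
    log_likelihood g xs <= log_likelihood f xs.

Definition gaussian_density (x : 'rV[R]_d) : R :=
  (\prod_(i < d) normal_pdf 0 1 (x ord0 i))%R.

(** The maximiser, with an arbitrary log-concave density as default on the
    (null, for [d < t]) set of samples that have none.  All maximisers take the
    same values at the sample points. *)
Definition mle t (xs : t.-tuple 'rV[R]_d) : 'rV[R]_d -> R :=
  xget gaussian_density [set f | is_mle xs f].

Variable E : forall t, t.-tuple 'rV[R]_d -> 'rV[R]_d -> R.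

Definition ULR t x : R :=
  if (t <= d)%N then 1%R
  else (\prod_(d <= s < t) (E (sample_prefix s x) (x s) / mle (sample_prefix t x) (x s)))%R.

Definition regret p t x : \bar R :=
  \sum_(0 <= s < t) (lne (p (x s))%:E - lne (E (sample_prefix s x) (x s))%:E).

(** [l] is the log-concave projection of [p], unique as a law; [hellinger p l]
    does not depend on the choice of its density. *)
Definition Q (c : R) : set ('rV[R]_d -> R) :=
  [set p : 'rV[R]_d -> R | D1 R d p /\ exists l, log_concave_projection p l /\
    iid_almost_surely p [set x |
      limn_esup (fun t => regret p t x * ((t%:R * hellinger p l ^+ 2)^-1)%:E)
        <= c%:E]].

Definition rejection_time (alpha : R) x : \bar R :=
  ereal_inf [set t%:R%:E | t in [set t | (1 <= t)%N /\
                                         (alpha^-1 <= ULR t x)%R]].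

End universal_likelihood_ratio.

(* Main.v *)
Require Import Defs.
From mathcomp Require Import all_boot all_order all_algebra.
From mathcomp Require Import all_classical all_reals all_analysis.
From mathcomp Require Import measurable_realfun lra ring zify.
Import Order.TTheory GRing.Theory Num.Theory.
Import numFieldNormedType.Exports.
Local Open Scope classical_set_scope.
Local Open Scope ring_scope.

(** Write [h] for the squared Hellinger distance between [p] and its log-concave
    projection.  It is positive when [p] is not in [L], and it is at most
    [KL p l] for every [l] in [L], because the projection minimises the
    divergence ([hellinger_le_KL]).  The logarithm of [ULR E t] is minus the
    regret accumulated since time [d], minus the logarithm of the likelihood ratio
    of the maximum likelihood estimate to [p] on the same observations.  With
    [c = 1/2] the regret is at most [5/8 * t * h] in the long run, so it is
    enough that the likelihood ratio of the estimate to [p] is at most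
    [expR (- 3/4 * t * h)], up to a constant factor.

    The estimate depends on the sample, so this bound has to hold at once for
    all log-concave [f] of integral at most one
    ([subdensity_likelihood_bound]); the rate can be any [a] below the
    divergence from [p] to all of [L].

    For a single function a small power of the likelihood ratio has expectation
    less than [expR (- lam * a)] per observation; independence, Markov's
    inequality and the Borel-Cantelli lemma give the bound almost surely
    ([iid_chernoff]).  A uniform bound follows if finitely many functions with
    this property dominate the whole class ([uniform_likelihood_bound]).  Step
    functions on finer and finer grids serve as dominating functions.  If they
    failed at every fineness, with powers tending to zero, there would be a
    sequence of log-concave functions along which, after passing to a
    subsequence, the step functions are asymptotically no larger than the lower
    limit [l] of the sequence, almost everywhere ([logconcave_compactness]).
    Since [(y `^ mu - 1) / mu] decreases to the logarithm of [y] as [mu]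
    decreases to [0], Fatou's lemma bounds the divergence from [p] to [l] by
    [a] ([weighted_entropy_limit]).  But [l] is log-concave of integral at most
    one, so after normalisation it is a member of [L] at divergence at most
    [a]: a contradiction.

    Two points remain.  The functions [1 / p] need a finite small moment, which
    follows from the finite first moment of [p] ([negative_moment]).  And the
    functions [f] are not uniformly bounded: those with a large maximum [expR m]
    are treated by applying the same argument to their roots of order [m]
    ([tall_root_bound]).  Such an [f] takes large values on a small volume only, and
    the higher its peak, the faster its likelihood decreases with the sample
    size; for high enough peaks this beats the growth of the product of the
    values of [1 / p]. *)
(** * Preliminaries *)

Section real_preliminaries.
Context {R : realType}.

Lemma lne0 : lne (0%:E : \bar R) = -oo%E.
Proof. by rewrite /lne lexx. Qed.

Lemma lne_eqNy (r : R) : lne r%:E = -oo%E -> r <= 0.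
Proof. by rewrite /lne; case: ifPn. Qed.

Lemma powR_prod {I : Type} (r : seq I) (A : pred I) (F : I -> R) (t : R) :
  (forall i, 0 <= F i) ->
  (\prod_(i <- r | A i) F i) `^ t = \prod_(i <- r | A i) F i `^ t.
Proof.
move=> F0; suff [] : 0 <= \prod_(i <- r | A i) F i /\
  (\prod_(i <- r | A i) F i) `^ t = \prod_(i <- r | A i) F i `^ t by [].
apply: (big_ind2 (fun u w => 0 <= u /\ u `^ t = w)) => [|u1 u w1 w [u0 <-] [w0 <-]|//].
  by split => //; rewrite powR1.
by split; [exact: mulr_ge0|rewrite powRM].
Qed.

Lemma small_inv (e : R) : 0 < e -> exists n : nat, exists2 h, n.+1%:R^-1 = h & 0 < h < e.
Proof.
move=> e0; have [n] := @ltr_add_invr R 0 e e0.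
by rewrite add0r => ne; exists n, n.+1%:R^-1 => //; rewrite ne andbT.
Qed.

Lemma finite_lower_bound (I : finType) (F : I -> R) : (forall i, 0 < F i) ->
  exists2 r, 0 < r & forall i, r <= F i.
Proof.
move=> F0; exists (\big[Num.min/1]_i F i).
  by elim/big_ind : _ => // u v u0 v0; rewrite lt_min u0.
by move=> i; apply: bigmin_le_cond.
Qed.

Lemma exists_argmax (f : nat -> R) (a b : nat) : (a < b)%N ->
  exists2 i, (a <= i < b)%N & forall j, (a <= j < b)%N -> (f j <= f i)%R.
Proof.
elim: b => // b IH; rewrite ltnS leq_eqVlt => /orP[/eqP ->|ab].
  by exists b; [rewrite leqnn/=|move=> j jb; rewrite (_ : j = b)//; lia].
have [i iab fi] := IH ab; have [fb|fb] := leP (f b) (f i).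
  exists i; first lia.
  move=> j jab; have [->//|jb] := eqVneq j b; apply: fi; lia.
exists b; first lia.
move=> j jab; have [->//|jb] := eqVneq j b; apply: le_trans (ltW fb).
by apply: fi; lia.
Qed.

(** Used with [s] an almost maximal value near a point and [c] a rough lower
    bound around it: moving almost all of the weight to [s] costs next to
    nothing. *)
Lemma powR_weight (s c s' : R) : 0 < c -> 0 <= s' -> s' < s ->
  exists2 t, 0 < t < 1 & s' < s `^ t * c `^ (1 - t).
Proof.
move=> c0 s'0 s's; have s0 : 0 < s by exact: le_lt_trans s's.
wlog s'pos : s' s'0 s's / 0 < s'.
  move=> H; have [|||t t01 ht] := H (Num.max s' (s / 2)).
  - by rewrite le_max s'0.
  - by rewrite gt_max s's; lra.
  - by rewrite lt_max (divr_gt0 s0)// orbT.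
  - by exists t => //; apply: le_lt_trans ht; rewrite le_max lexx.
pose A := ln s - ln s'; pose B := `|ln s - ln c|.
have A0 : 0 < A by rewrite subr_gt0 ltr_ln ?posrE.
have B0 : 0 <= B by exact: normr_ge0.
have AB0 : 0 < A + B + 1 by lra.
pose u := A / (A + B + 1).
have u0 : 0 < u by exact: divr_gt0.
have u1 : u < 1 by rewrite ltr_pdivrMr//; lra.
have uB : u * B < A by rewrite mulrAC ltr_pdivrMr//; nra.
exists (1 - u); first by apply/andP; split; lra.
rewrite opprB addrCA subrr addr0 /powR (gt_eqF s0) (gt_eqF c0) -expRD.
rewrite -[X in X < _]lnK ?posrE// ltr_expR.
have : ln s - ln c <= B by exact: ler_norm.
by move: uB; rewrite /A; nra.
Qed.

End real_preliminaries.

Section box_cox.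
Context {R : realType}.

(** The quotients are the slopes at [0] of the chords of the convex function
    sending [mu] to [y `^ mu].  Monotonicity provides the majorant for Fatou's
    lemma. *)
Lemma box_cox_le (y mu lam : R) : 0 <= y -> 0 < mu -> mu <= lam ->
  (y `^ mu - 1) / mu <= (y `^ lam - 1) / lam.
Proof.
move=> y0 mu0 mul; have lam0 : 0 < lam by exact: lt_le_trans mul.
have [->|yn0] := eqVneq y 0.
  rewrite !powR0 ?gt_eqF// !sub0r !mulN1r lerN2 lef_pV2//.
rewrite ler_pdivlMr// mulrAC ler_pdivrMr//.
rewrite /powR (negPf yn0); set u := ln y.
have h1 := expR_ge1Dx ((lam - mu) * u); have h2 := expR_ge1Dx (- (mu * u)).
have e1 : expR (mu * u) * expR ((lam - mu) * u) = expR (lam * u).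
  by rewrite -expRD; congr expR; ring.
have e2 : expR (mu * u) * expR (- (mu * u)) = 1 by rewrite -expRD subrr expR0.
have e0 := expR_gt0 (mu * u).
have k1 := ler_wpM2l (ltW e0) h1; have k2 := ler_wpM2l (ltW e0) h2.
have l0 : 0 <= lam - mu by lra.
have k1' := ler_wpM2l (ltW mu0) k1; have k2' := ler_wpM2l l0 k2.
rewrite e1 in k1'; rewrite e2 in k2'; lra.
Qed.

(** The upper bound tends to [r] as [mu] tends to [0], so the quotient is at most
    the logarithm of [y] in the limit; stated with [r] in place of the logarithm
    it also covers [y = 0]. *)
Lemma box_cox_le_log (y mu r : R) : 0 <= y -> 0 < mu -> y <= expR r ->
  (y `^ mu - 1) / mu <= r * expR (r * mu).
Proof.
move=> y0 mu0 yr; rewrite ler_pdivrMr//.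
have h : y `^ mu <= expR (r * mu).
  have -> : expR (r * mu) = expR r `^ mu.
    by rewrite /powR gt_eqF ?expR_gt0// expRK mulrC.
  by apply: ge0_ler_powR; rewrite ?nnegrE ?expR_ge0// ltW.
have := expR_ge1Dx (- (r * mu)); rewrite expRN => k.
have := ler_wpM2l (expR_ge0 (r * mu)) k.
rewrite divff ?gt_eqF ?expR_gt0// => k'; move: h k'; lra.
Qed.

Lemma near_mul_expR_lt (r r' : R) (mu : nat -> R) : r' < r ->
  mu j @[j --> \oo] --> (0 : R) -> \forall j \near \oo, r' * expR (r' * mu j) < r.
Proof.
move=> rr' mu0.
have : r' * expR (r' * mu j) @[j --> \oo] --> r' * expR (r' * 0).
  apply: cvgMr; apply: continuous_cvg; first exact: continuous_expR.
  exact: cvgMr.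
rewrite mulr0 expR0 mulr1 => /cvgr_lt; exact.
Qed.

End box_cox.

Section liminf.
Context {R : realType}.

Lemma limn_einf_ge (c : \bar R) (u : nat -> \bar R) :
  (\forall j \near \oo, (c <= u j)%E) -> (c <= limn_einf u)%E.
Proof.
move=> [N _ HN]; rewrite limn_einf_lim (cvg_lim _ (@cvg_einfs_sup _ u))//.
apply: le_trans (ereal_sup_ubound _); last by exists N.
by apply: le_ereal_inf_tmp => _ [j /= Nj <-]; exact: HN.
Qed.

Lemma limn_einf_le (c : \bar R) (u : nat -> \bar R) :
  (forall j, (u j <= c)%E) -> (limn_einf u <= c)%E.
Proof.
move=> uc; rewrite limn_einf_lim (cvg_lim _ (@cvg_einfs_sup _ u))//.
apply: ge_ereal_sup => _ [n _ <-]; apply: le_trans (uc n).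
by apply: ereal_inf_lbound; exists n => /=.
Qed.

Lemma limn_einf_gt (c : \bar R) (u : nat -> \bar R) :
  (c < limn_einf u)%E -> \forall j \near \oo, (c < u j)%E.
Proof.
rewrite limn_einf_lim (cvg_lim _ (@cvg_einfs_sup _ u))// => /ereal_sup_gt[_ [n _ <-] cn].
exists n => // j /= nj; apply: lt_le_trans cn _.
by apply: ereal_inf_lbound; exists j.
Qed.

End liminf.

Lemma countable_bigcup_measurable {dT} {T : sigmaRingType dT} {I : countType}
    (A : set I) (F : I -> set T) : (forall i, A i -> measurable (F i)) ->
  measurable (\bigcup_(i in A) F i).
Proof.
move=> mF; rewrite bigcup_mkcond; apply: countable_bigcupT_measurable => // i.
by case: ifPn => [/set_mem/mF//|_]; exact: measurable0.
Qed.

Section measurability.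
Context {R : realType} {dT : measure_display} {T : measurableType dT}.

Lemma measurable_lne_EFin (g : T -> R) :
  measurable_fun setT g -> measurable_fun setT (fun x => lne (g x)%:E).
Proof.
move=> mg; rewrite (_ : (fun x => _) =
    fun x => if g x <= 0 then -oo%E else (ln (g x))%:E); last exact/funext.
apply: measurable_fun_if => //.
- by apply: measurable_fun_ler => //; exact: measurable_cst.
- by apply/measurable_funTS/measurable_EFinP; exact: measurableT_comp.
Qed.

Lemma measurable_fun_limn_einf
    (f : nat -> T -> \bar R) : (forall n, measurable_fun setT (f n)) ->
  measurable_fun setT (fun x => limn_einf (f^~ x)).
Proof.
move=> mf; apply: measurableT_comp => //; apply: measurable_fun_limn_esup => n.
exact: measurableT_comp.
Qed.

Lemma measurable_inv_ge0 (g : T -> R) :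
  measurable_fun setT g -> (forall x, 0 <= g x) -> measurable_fun setT (fun x => (g x)^-1).
Proof.
move=> mg g0; rewrite (_ : (fun x => _) = fun x => g x `^ (-1)).
  exact: (measurableT_comp (measurable_powR _) mg).
by apply/funext => x; rewrite powR_inv1.
Qed.

Local Open Scope ereal_scope.

(** The positive and the negative parts are compared separately, which is how
    integrals with infinite values are defined. *)
Lemma integral_mono (mu : {measure set T -> \bar R}) (f g : T -> \bar R) :
  measurable_fun setT f -> measurable_fun setT g ->
  (forall x, f x <= g x) -> \int[mu]_x f x <= \int[mu]_x g x.
Proof.
move=> mf mg fg; rewrite integralE [leRHS]integralE; apply: leeB.
- apply: ge0_le_integral => //; [exact: measurable_funepos|exact: measurable_funepos|].
  by move=> x _; apply: (@funepos_le _ _ setT) => [y _|]; rewrite ?inE.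
- apply: ge0_le_integral => //; [exact: measurable_funeneg|exact: measurable_funeneg|].
  by move=> x _; apply: (@funeneg_le _ _ setT) => [y _|]; rewrite ?inE.
Qed.

End measurability.

(** * Independent samples *)

Section indicator_transfer.
Local Open Scope ereal_scope.
Import HBNNSimple.
Context {d1 d2 : measure_display} {T1 : measurableType d1}
  {T2 : measurableType d2} {R : realType}.
Variables (m1 : {measure set T1 -> \bar R}) (m2 : {measure set T2 -> \bar R}).
Variables (X : T1 -> T2) (H : T1 -> R) (h : T2 -> R) (c : R).
Hypotheses (mX : measurable_fun setT X) (mH : measurable_fun setT H)
  (mh : measurable_fun setT h) (H0 : forall x, (0 <= H x)%R)
  (h0 : forall y, (0 <= h y)%R) (c0 : (0 <= c)%R).
Hypothesis indicE : forall B, measurable B ->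
  \int[m1]_x (H x * \1_B (X x))%:E = c%:E * \int[m2]_y (h y * \1_B y)%:E.

(** Independence is only given for events, that is, for products of indicators.
    This is the passage from indicators to nonnegative functions, one factor at
    a time: [H] is the product of the other factors, and [h] is the density of
    the observation [X]. *)
Lemma ge0_integral_transfer (g : T2 -> R) :
  measurable_fun setT g -> (forall y, (0 <= g y)%R) ->
  \int[m1]_x (H x * g (X x))%:E = c%:E * \int[m2]_y (h y * g y)%:E.
Proof.
move=> mg g0.
have mg' : measurable_fun setT (EFin \o g) by apply/measurable_EFinP.
pose s := nnsfun_approx measurableT mg'.
have cvs y : (s n y)%:E @[n --> \oo] --> (g y)%:E.
  by apply: cvg_nnsfun_approx => // x _ /=; rewrite lee_fin.
have nds y : {homo (fun n => s n y) : m n / (m <= n)%N >-> (m <= n)%R}.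
  by move=> m n mn; exact/lefP/nd_nnsfun_approx.
have ms n : measurable_fun setT (s n) by exact: measurable_funP.
have simpleE n : \int[m1]_x (H x * s n (X x))%:E
    = c%:E * \int[m2]_y (h y * s n y)%:E.
  have sE y : s n y = (\sum_(r <- finmap.enum_fset (fset_set (range (s n))))
      r * \1_(s n @^-1` [set r]) y)%R.
    by rewrite (fimfunE (s n) y) fsbig_finite.
  have r0 r y : (0 <= r * \1_(s n @^-1` [set r]) y :> R)%R.
    by have := nnfun_muleindic_ge0 (s n) r y; rewrite lee_fin.
  have mi r : measurable_fun setT
      (fun y => (r * \1_(s n @^-1` [set r]) y)%R).
    by apply: measurable_funM => //; exact: measurable_indic.
  under eq_integral do rewrite sE mulr_sumr -sumEFin.
  rewrite ge0_integral_sum//=; last 2 first.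
  - move=> r; apply/measurable_EFinP/measurable_funM => //.
    exact: (measurableT_comp (mi r)).
  - by move=> r x _; rewrite lee_fin mulr_ge0.
  under [in RHS]eq_integral do rewrite sE mulr_sumr -sumEFin.
  rewrite ge0_integral_sum//=; last 2 first.
  - by move=> r; apply/measurable_EFinP/measurable_funM.
  - by move=> r x _; rewrite lee_fin mulr_ge0.
  rewrite ge0_sume_distrr; last first.
    by move=> r _; apply: integral_ge0 => x _; rewrite lee_fin mulr_ge0.
  apply: eq_bigr => r _.
  have [->|rn0] := eqVneq (s n @^-1` [set r]) set0.
    by rewrite !integral0_eq ?mule0// => x _; rewrite indic0 !mulr0.
  have r0' : (0 <= r)%R by case/set0P : rn0 => y /= <-.
  have mB : measurable (s n @^-1` [set r]) by [].
  under eq_integral do rewrite mulrCA EFinM.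
  rewrite ge0_integralZl//; last 2 first.
  - apply/measurable_EFinP/measurable_funM => //.
    by apply: (measurableT_comp _ mX); exact: measurable_indic.
  - by move=> x _; rewrite lee_fin mulr_ge0.
  rewrite indicE//.
  under [in RHS]eq_integral do rewrite mulrCA EFinM.
  rewrite ge0_integralZl//; first by rewrite muleCA.
  - by apply/measurable_EFinP/measurable_funM => //; exact: measurable_indic.
  - by move=> x _; rewrite lee_fin mulr_ge0.
have cvl : \int[m1]_x (H x * s n (X x))%:E @[n --> \oo] -->
    \int[m1]_x (H x * g (X x))%:E.
  have -> : \int[m1]_x (H x * g (X x))%:E
      = \int[m1]_x limn (fun n => (H x * s n (X x))%:E).
    apply: eq_integral => x _; apply/esym/cvg_lim => //.
    by under eq_fun do rewrite EFinM; rewrite EFinM; apply: cvgeZl.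
  apply: cvg_monotone_convergence => //.
  - move=> n; apply/measurable_EFinP/measurable_funM => //.
    exact: (measurableT_comp (ms n)).
  - by move=> n x _; rewrite lee_fin mulr_ge0.
  - by move=> x _ m n mn; rewrite lee_fin ler_wpM2l// nds.
have cvr : \int[m2]_y (h y * s n y)%:E @[n --> \oo] -->
    \int[m2]_y (h y * g y)%:E.
  have -> : \int[m2]_y (h y * g y)%:E
      = \int[m2]_y limn (fun n => (h y * s n y)%:E).
    apply: eq_integral => x _; apply/esym/cvg_lim => //.
    by under eq_fun do rewrite EFinM; rewrite EFinM; apply: cvgeZl.
  apply: cvg_monotone_convergence => //.
  - by move=> n; apply/measurable_EFinP/measurable_funM.
  - by move=> n x _; rewrite lee_fin mulr_ge0.
  - by move=> x _ m n mn; rewrite lee_fin ler_wpM2l// nds.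
apply: cvg_unique cvl _ => //.
by rewrite (_ : (fun _ => _) = (fun n => c%:E * \int[m2]_y (h y * s n y)%:E));
  [apply: cvgeZl|apply/funext].
Qed.
End indicator_transfer.

Section borel_cantelli_geometric.
Local Open Scope ereal_scope.

(** The Borel-Cantelli lemma: the probabilities are summable. *)
Lemma ae_eventually_geometric {d0 : measure_display} {T : measurableType d0}
    {R : realType} (P : {measure set T -> \bar R}) (F : nat -> set T) (q : R) :
  (0 <= q < 1)%R -> (forall n, measurable (F n)) ->
  (forall n, P (F n) <= (q ^+ n)%:E) ->
  {ae P, forall x, \forall n \near \oo, ~ F n x}.
Proof.
move=> /andP[q0 q1] mF PF.
exists (lim_sup_set F); split.
- by apply: bigcap_measurable => // n _; apply: bigcup_measurable.
- apply: lim_sup_set_cvg0 => //.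
  apply: (@le_lt_trans _ _ ((1 - q)^-1)%:E); last exact: ltry.
  apply: lime_le; first by apply: is_cvg_nneseries => n _ _; exact: measure_ge0.
  apply: nearW => n; apply: (@le_trans _ _ (\sum_(0 <= k < n) (q ^+ k)%:E)).
    by apply: lee_sum => k _.
  rewrite sumEFin lee_fin big_mkord.
  have q1' : (0 < 1 - q)%R by rewrite subr_gt0.
  rewrite -div1r ler_pdivlMr//.
  have := subrX1 q n; have := exprn_ge0 n q0; lra.
- move=> x /= nx n _ /=; apply: contrapT => nF; apply: nx.
  by exists n => // k /= nk Fk; apply: nF; exists k.
Qed.
End borel_cantelli_geometric.

Section iid_products.
Local Open Scope ereal_scope.
Context {R : realType} {d : nat} (p : 'rV[R]_d -> R) (Dp : D R d p).
Variables (P : probability (sample_path R d) R) (iidP : iid_law p P).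

Lemma measurable_observation s :
  measurable_fun setT (fun x : sample_path R d => x s).
Proof.
move=> _ B mB; rewrite setTI; apply: sub_sigma_algebra.
by exists s => //; exists B => //; rewrite setTI.
Qed.

Lemma measurable_prod_observations (A : pred nat) (r : seq nat) (G : nat -> 'rV[R]_d -> R) :
  (forall i, measurable_fun setT (G i)) ->
  measurable_fun setT (fun x : sample_path R d => (\prod_(i <- r | A i) G i (x i))%R).
Proof.
move=> mG.
rewrite (_ : (fun x => _) = fun x => \prod_(i <- [seq i <- r | A i]) G i (x i))%R;
  last by apply/funext => x; rewrite big_filter.
by apply: measurable_prod => i _; apply: measurableT_comp (mG i) (measurable_observation i).
Qed.

Lemma iid_expectation_prod n (G : nat -> 'rV[R]_d -> R) (r : nat -> R) :
  (forall i, measurable_fun setT (G i)) -> (forall i y, (0 <= G i y)%R) ->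
  (forall i, \int[leb R d]_y (p y * G i y)%:E = (r i)%:E) ->
  \int[P]_x (\prod_(0 <= i < n) G i (x i))%:E = (\prod_(0 <= i < n) r i)%:E.
Proof.
have [mp p0 _] := Dp.
have law_indic B : measurable B -> \int[leb R d]_y (p y * \1_B y)%:E = law p B.
  move=> mB; rewrite /law [RHS]integral_mkcond; apply: eq_integral => y _.
  by rewrite patchE indicE; case: ifPn; rewrite ?mulr1 ?mulr0.
suff: forall j (G : nat -> 'rV[R]_d -> R) (r : nat -> R),
  (forall i, measurable_fun setT (G i)) -> (forall i y, (0 <= G i y)%R) ->
  (forall i, \int[leb R d]_y (p y * G i y)%:E = (r i)%:E) ->
  (forall i, (j <= i < n)%N -> exists2 B, measurable B & G i = \1_B) ->
  \int[P]_x (\prod_(0 <= i < n) G i (x i))%:E = (\prod_(0 <= i < n) r i)%:E.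
  by move=> /(_ n) H mG G0 Gr; apply: H => // i; case: leqP => // + /andP[_]; lia.
move=> {G r} j; elim: j => [|j IH] G r mG G0 Gr GB.
  have /choice[B HB] : forall i, exists B, measurable B /\ ((i < n)%N -> G i = \1_B).
    move=> i; case: (ltnP i n) => [ltin|]; last by exists set0; split.
    by have [B mB EB] := GB i ltin; exists B.
  have mB i : measurable (B i) by case: (HB i).
  pose A := [set x : sample_path R d | forall i, (i < n)%N -> B i (x i)].
  have AE : A = \bigcap_(i < n) ((fun x : sample_path R d => x i) @^-1` B i).
    by apply/seteqP; split => x Ax i lin; exact: (Ax i lin).
  have E x : (\prod_(0 <= i < n) G i (x i) = \1_A x)%R.
    rewrite indicE; case: (asboolP (A x)) => [Ax|nAx].
      rewrite mem_set// big_mkord big1// => i _.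
      have [_ ->//] := HB i; rewrite indicE mem_set//; exact: Ax.
    rewrite memNset//; move/existsNP: nAx => [i /not_implyP[ltin nB]].
    rewrite big_mkord (bigD1 (Ordinal ltin))//=.
    by have [_ ->//] := HB i; rewrite indicE memNset// mul0r.
  under eq_integral do rewrite E.
  have mA : measurable A.
    rewrite AE; apply: fin_bigcap_measurable => [|i _]; first exact: finite_II.
    by rewrite -[X in measurable X]setTI; exact: measurable_observation.
  rewrite integral_indic// setIT.
  transitivity (\prod_(i < n) law p (B i)); first exact: (iidP n B mB).
  rewrite big_mkord -prodEFin; apply: eq_bigr => i _.
  by rewrite -Gr -law_indic//; have [_ ->//] := HB i.
case: (ltnP j n) => [jn|nj]; last first.
  by apply: IH => // i /andP[ji lin]; exfalso; lia.
pose H x := (\prod_(0 <= i < n | i != j) G i (x i))%R.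
pose c := (\prod_(0 <= i < n | i != j) r i)%R.
have jD1 (F : nat -> R) : (\prod_(0 <= i < n) F i = F j * \prod_(0 <= i < n | i != j) F i)%R.
  by rewrite (bigD1_seq j)//= ?mem_index_iota// iota_uniq.
have HE x : (\prod_(0 <= i < n) G i (x i) = H x * G j (x j))%R.
  by rewrite jD1 mulrC.
under eq_integral do rewrite HE.
have r0 i : (0 <= r i)%R.
  by rewrite -lee_fin -Gr integral_ge0// => y _; rewrite lee_fin mulr_ge0.
rewrite (@ge0_integral_transfer _ _ _ _ R P (leb R d)
  (fun x : sample_path R d => x j) H p c)//.
- by rewrite Gr jD1 -EFinM mulrC.
- exact: measurable_observation.
- exact: measurable_prod_observations.
- by move=> x; rewrite /H; apply: prodr_ge0.
move=> B mB.
(* After replacing the factor of index j by an indicator, the induction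
   hypothesis applies. *)
pose G' i := if i == j then \1_B else G i.
pose r' i := if i == j then fine (law p B) else r i.
have Bfin : law p B = (fine (law p B))%:E.
  rewrite fineK// ge0_fin_numE; last first.
    by apply: integral_ge0 => y _; rewrite lee_fin.
  have [_ _ p1] := Dp; apply: (@le_lt_trans _ _ 1); last exact: ltry.
  rewrite -p1; apply: ge0_subset_integral => //.
  - exact/measurable_EFinP.
  - by move=> y _; rewrite lee_fin.
have := IH G' r'; rewrite !jD1 /r' /G' eqxx.
have E1 x : (\prod_(0 <= i < n | i != j) (if i == j then \1_B else G i) (x i) = H x)%R.
  by apply: eq_bigr => i /negPf ->.
have -> : (\prod_(0 <= i < n | i != j) (if i == j then fine (law p B) else r i) = c)%R.
  by apply: eq_bigr => i /negPf ->.
rewrite EFinM -Bfin -law_indic// [RHS]muleC => <-.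
- by apply: eq_integral => x _; rewrite jD1 eqxx E1 mulrC.
- by move=> i; case: ifP => _ //; exact: measurable_indic.
- by move=> i y; case: ifP => _ //; rewrite indicE.
- by move=> i; case: ifP => _ //; rewrite law_indic.
- move=> i /andP[ji lin]; case: ifPn => [_|ij]; first by exists B.
  by apply: GB; lia.
Qed.

(** The hypothesis says that the expectation of [g `^ lam] at one observation is
    below [expR (- lam * a)], so the probability that the product exceeds the
    bound decreases geometrically in the number of factors. *)
Lemma iid_chernoff (g : 'rV[R]_d -> R) (lam a : R) (d0 : nat) :
  measurable_fun setT g -> (forall y, (0 <= g y)%R) -> (0 < lam)%R ->
  \int[leb R d]_y (p y * g y `^ lam)%:E < (expR (- lam * a))%:E ->
  {ae P, forall x : sample_path R d, \forall t \near \oo,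
    (\prod_(d0 <= s < t) g (x s) <= expR (- a * (t%:R - d0%:R)))%R}.
Proof.
move=> mg g0 lam0 gl.
have [mp p0 p1] := Dp.
have mgl : measurable_fun setT (fun y => g y `^ lam)%R.
  by exact: (measurableT_comp (measurable_powR lam) mg).
pose I := \int[leb R d]_y (p y * g y `^ lam)%:E.
have I0 : 0 <= I.
  by apply: integral_ge0 => y _; rewrite lee_fin mulr_ge0// powR_ge0.
pose r := fine I.
have rE : I = r%:E by rewrite fineK// ge0_fin_numE// (lt_trans gl)// ltry.
have r0 : (0 <= r)%R by rewrite fine_ge0.
have rl : (r < expR (- lam * a))%R by rewrite -lte_fin -rE.
pose q := (r * expR (lam * a))%R.
have q01 : (0 <= q < 1)%R.
  rewrite mulr_ge0 ?expR_ge0//= -ltr_pdivlMr ?expR_gt0// div1r -expRN.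
  by rewrite -mulNr.
pose Z n (x : sample_path R d) := (\prod_(d0 <= s < n + d0) g (x s))%R.
have Z0 n x : (0 <= Z n x)%R by apply: prodr_ge0.
have mZ n : measurable_fun setT (Z n).
  exact: (@measurable_prod_observations xpredT (index_iota d0 (n + d0)) (fun=> g)).
pose F n := [set x | (expR (- a * n%:R) < Z n x)%R].
have mF n : measurable (F n).
  rewrite (_ : F n = Z n @^-1` `]expR (- a * n%:R), +oo[); last first.
    by apply/seteqP; split => x; rewrite /F /= in_itv/= andbT.
  by rewrite -[X in measurable X]setTI; exact: mZ.
(* The product starts at d0; the earlier factors are taken equal to 1. *)
have EZ n : \int[P]_x (Z n x `^ lam)%:E = (r ^+ n)%:E.
  pose G i y := if (i < d0)%N then 1%R else (g y `^ lam)%R.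
  pose r' i := if (i < d0)%N then 1%R else r.
  have split_prod (h : nat -> R) : (\prod_(0 <= i < n + d0) (if (i < d0)%N then 1 else h i)
      = \prod_(d0 <= i < n + d0) h i)%R.
    rewrite (@big_cat_nat _ _ _ d0)//= ?leq_addl//.
    rewrite big_nat big1 => [|i /andP[_ ->]//]; rewrite mul1r.
    by apply: eq_big_nat => i /andP[di _]; rewrite ltnNge di.
  have := @iid_expectation_prod (n + d0)%N G r'.
  rewrite (split_prod (fun=> r)) prodr_const_nat addnK => <-.
  - apply: eq_integral => x _; rewrite (split_prod (fun i => g (x i) `^ lam)%R); congr EFin.
    exact: powR_prod.
  - by move=> i; rewrite /G; case: (i < d0)%N.
  - by move=> i y; rewrite /G; case: ifP => _ //; exact: powR_ge0.
  - move=> i; rewrite /G /r'; case: (i < d0)%N => //.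
    by under eq_integral do rewrite mulr1.
have PF n : P (F n) <= (q ^+ n)%:E.
  have : \int[P]_x ((expR (- a * n%:R) `^ lam)%:E * (\1_(F n) x)%:E) <= (r ^+ n)%:E.
    rewrite -EZ; apply: ge0_le_integral => //.
    - by apply: emeasurable_funM => //; apply/measurable_EFinP; exact: measurable_indic.
    - by apply/measurable_EFinP; exact: (measurableT_comp (measurable_powR lam) (mZ n)).
    move=> x _; rewrite -EFinM lee_fin indicE; case: (asboolP (F n x)) => Fx.
      rewrite mem_set// mulr1 ge0_ler_powR ?nnegrE ?expR_ge0//; first exact: ltW.
      exact: ltW Fx.
    by rewrite memNset// mulr0 powR_ge0.
  rewrite ge0_integralZl//; last first.
    by apply/measurable_EFinP; exact: measurable_indic.
  rewrite integral_indic// setIT => PFr.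
  have : (expR (- a * n%:R) `^ lam)%:E * P (F n) <= (r ^+ n)%:E := PFr.
  have -> : P (F n) = (fine (P (F n)))%:E by rewrite fineK// fin_num_measure.
  have wE : (expR (- a * n%:R) `^ lam = (expR (lam * a) ^+ n)^-1)%R.
    rewrite /powR gt_eqF ?expR_gt0// expRK -expRM_natr -expRN; congr expR; ring.
  rewrite -EFinM !lee_fin wE exprMn ler_pdivrMl ?exprn_gt0 ?expR_gt0//.
  by rewrite mulrC.
have := @ae_eventually_geometric _ _ _ P F q q01 mF PF; apply: filterS => x [N _ HN].
exists (N + d0)%N => // t /= Nt.
have dt : (d0 <= t)%N by lia.
have := HN (t - d0)%N; rewrite /= /F /Z subnK// natrB// => /(_ ltac:(lia)) /negP.
by rewrite -leNgt.
Qed.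

End iid_products.

(** * Convex sets *)

Section convexity.
Context {R : realType}.

Definition segment_closed {d} (K : set 'rV[R]_d) :=
  forall x y (t : R), K x -> K y -> 0 <= t <= 1 -> K (t *: x + (1 - t) *: y).

(** Coordinates are matched with those of [x] one at a time.  At coordinate [k],
    two points of [K] lie on either side of [x], and they agree with [x] in the
    earlier coordinates; a point of the segment between them agrees with [x] at
    [k] too, and it stays in the required orthant in the later coordinates. *)
Lemma orthants_meet_convex {d} (K : set 'rV[R]_d) (x : 'rV[R]_d) :
  segment_closed K ->
  (forall s : 'I_d -> bool, exists2 y, K y &
     forall i, if s i then x ord0 i <= y ord0 i else y ord0 i <= x ord0 i) ->
  K x.
Proof.
move=> cK orth.
suff: forall j, (j <= d)%N -> forall s : 'I_d -> bool, exists2 y, K y &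
    forall i : 'I_d, if (i < j)%N then y ord0 i = x ord0 i else
      if s i then x ord0 i <= y ord0 i else y ord0 i <= x ord0 i.
  move=> /(_ d (leqnn d) (fun=> true))[y Ky yx].
  suff -> : x = y by [].
  by apply/rowP => i; have := yx i; rewrite ltn_ord => ->.
elim=> [_ s|j IH jd s]; first by have [y Ky yx] := orth s; exists y.
pose k := Ordinal jd.
have [y Ky yx] := IH (ltnW jd) (fun i => (i == k) || s i).
have [z Kz zx] := IH (ltnW jd) (fun i => (i != k) && s i).
have := yx k; rewrite ltnn eqxx/= => xyk.
have := zx k; rewrite ltnn eqxx/= => zxk.
have side (i : 'I_d) : (i < j.+1)%N -> i = k \/ (i < j)%N.
  by rewrite ltnS leq_eqVlt => /orP[/eqP ij|]; [left; exact: val_inj|right].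
have [yz|yz] := eqVneq (y ord0 k) (z ord0 k).
  exists y => // i; case: ifPn => [ij|].
    have [->|ij'] := side i ij; first lra.
    by have := yx i; rewrite ij'.
  rewrite -leqNgt => ji; have := yx i.
  rewrite ltnNge (ltnW ji)/= (_ : i == k = false)//.
  by apply/eqP => ik; move: ji; rewrite ik ltnn.
have zy : z ord0 k < y ord0 k by rewrite lt_neqAle eq_sym yz/=; lra.
have zy0 : y ord0 k - z ord0 k != 0 by rewrite subr_eq0.
pose t := (x ord0 k - z ord0 k) / (y ord0 k - z ord0 k).
have t0 : 0 <= t by rewrite divr_ge0; lra.
have t1 : t <= 1 by rewrite ler_pdivrMr; lra.
exists (t *: y + (1 - t) *: z); first by apply: cK => //; rewrite t0.
move=> i; rewrite !mxE; case: ifPn => [ij|].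
  have [->|ij'] := side i ij.
    by rewrite /t; field.
  have := yx i; have := zx i; rewrite ij' => -> ->; ring.
rewrite -leqNgt => ji; have := yx i; have := zx i.
rewrite ltnNge (ltnW ji)/= (_ : i == k = false)/=; last first.
  by apply/eqP => ik; move: ji; rewrite ik ltnn.
by case: (s i) => h1 h2; nra.
Qed.

(** Rational ends make the boxes countably many: interiors become measurable, and
    the exceptional slices below are countably many. *)
Definition rat_box {d} (ab : 'rV[rat]_d * 'rV[rat]_d) : set 'rV[R]_d :=
  [set x | forall i, ratr (ab.1 ord0 i) < x ord0 i < ratr (ab.2 ord0 i)].

Definition rat_interior {d} (C : set 'rV[R]_d) : set 'rV[R]_d :=
  \bigcup_(ab in [set ab | rat_box ab `<=` C]) rat_box ab.

Lemma measurable_rat_box d (ab : 'rV[rat]_d * 'rV[rat]_d) : measurable (rat_box ab).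
Proof.
rewrite (_ : rat_box ab = \bigcap_(i in [set: 'I_d])
  ((fun x : 'rV[R]_d => x ord0 i) @^-1` `]ratr (ab.1 ord0 i), ratr (ab.2 ord0 i)[)).
  apply: fin_bigcap_measurable => [|i _]; first exact: finite_finset.
  by rewrite -[X in measurable X]setTI; exact: measurable_mx_entry.
apply/seteqP; split => x Bx i.
  by move=> _; have := Bx i; rewrite /= in_itv.
by have := Bx i Logic.I; rewrite /= in_itv.
Qed.

Lemma measurable_rat_interior d (C : set 'rV[R]_d) : measurable (rat_interior C).
Proof.
apply: countable_bigcup_measurable.
by move=> ab _; exact: measurable_rat_box.
Qed.

Definition cons_rat {d} (q : rat) (l : 'rV[rat]_d) : 'rV[rat]_d.+1 :=
  \row_j oapp (fun k => l ord0 k) q (unlift ord0 j).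

Lemma cons_rat0 d q (l : 'rV[rat]_d) : cons_rat q l ord0 ord0 = q.
Proof. by rewrite mxE unlift_none. Qed.

Lemma cons_ratS d q (l : 'rV[rat]_d) k : cons_rat q l ord0 (lift ord0 k) = l ord0 k.
Proof. by rewrite mxE liftK. Qed.

Lemma cons_rV_segment d (a b : R) (x y : 'rV[R]_d) (t : R) :
  cons_rV (t * a + (1 - t) * b, t *: x + (1 - t) *: y) =
  t *: cons_rV (a, x) + (1 - t) *: cons_rV (b, y).
Proof.
apply/rowP => i; case: (unliftP ord0 i) => [j|] ->.
  rewrite [RHS]mxE [X in _ = X + _]mxE [X in _ = _ + X]mxE !cons_rVS/=.
  by rewrite [LHS]mxE; congr (_ + _); rewrite mxE.
by rewrite [RHS]mxE [X in _ = X + _]mxE [X in _ = _ + X]mxE !cons_rV0.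
Qed.

Lemma between_segment (a b c : R) : a < c -> c < b ->
  exists2 t, 0 <= t <= 1 & c = t * a + (1 - t) * b.
Proof.
move=> ac cb; exists ((b - c) / (b - a)).
  by apply/andP; split; [rewrite divr_ge0; lra|rewrite ler_pdivrMr; lra].
by field; rewrite subr_eq0 gt_eqF//; lra.
Qed.

Section boundary_step.
Variables (d : nat) (C : set 'rV[R]_d.+1).
Hypothesis cC : segment_closed C.

Let slice (a : R) : set 'rV[R]_d := [set x | C (cons_rV (a, x))].

Let carrier (ab : 'rV[rat]_d * 'rV[rat]_d) : set R :=
  [set a | rat_box ab `<=` slice a].

(** For each rational box, the [a] whose slice contains the box form an interval;
    the exceptions are the ends of these intervals (the boolean tells which
    end), so they are countably many.  For any other [a], a box contained in the
    slice at [a] is also contained in the slices at a smaller and at a larger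
    point, hence by convexity in all the slices between. *)
Definition slice_exceptions : set R :=
  \bigcup_(i in [set: ('rV[rat]_d * 'rV[rat]_d) * bool])
    [set a | carrier i.1 a /\
       forall b, carrier i.1 b -> if i.2 then a <= b else b <= a].

Lemma countable_slice_exceptions : countable slice_exceptions.
Proof.
apply: bigcup_countable => // i _.
have sub1 (A : set R) : (forall a b, A a -> A b -> a = b) -> countable A.
  move=> A1; have [->|/set0P[a Aa]] := eqVneq A set0; first exact: countable0.
  by rewrite (_ : A = [set a])//; apply/seteqP; split=> [b Ab|b ->//]; exact: A1.
apply: sub1 => a b /= [ca ha] [cb hb]; apply/le_anti.
by have := ha b cb; have := hb a ca; case: ifP => _ -> ->.
Qed.

Lemma slice_segment_closed a : segment_closed (slice a).
Proof.
move=> x y t Cx Cy t01; rewrite /slice/=.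
have -> : a = t * a + (1 - t) * a by ring.
rewrite cons_rV_segment; exact: cC.
Qed.

Lemma rat_interior_slice a : ~ slice_exceptions a ->
  rat_interior (slice a) `<=` [set x | rat_interior C (cons_rV (a, x))].
Proof.
move=> aE x [[l u] /= lua xlu].
have [b1 cb1 b1a] : exists2 b, carrier (l, u) b & b < a.
  apply: contrapT => nb; apply: aE; exists ((l, u), true) => //; split => // b cb /=.
  by rewrite leNgt; apply/negP => ba; apply: nb; exists b.
have [b2 cb2 b2a] : exists2 b, carrier (l, u) b & a < b.
  apply: contrapT => nb; apply: aE; exists ((l, u), false) => //; split => // b cb /=.
  by rewrite leNgt; apply/negP => ba; apply: nb; exists b.
have [q1] := rat_in_itvoo b1a; rewrite in_itv/= => /andP[bq1 q1a].
have [q2] := rat_in_itvoo b2a; rewrite in_itv/= => /andP[aq2 q2b].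
exists (cons_rat q1 l, cons_rat q2 u); last first.
  move=> i /=; case: (unliftP ord0 i) => [j|] ->.
    by rewrite !cons_ratS cons_rVS/=; exact: xlu.
  by rewrite !cons_rat0 cons_rV0/= q1a.
move=> z /= zB.
have := zB ord0; rewrite /= !cons_rat0 => /andP[q1z zq2].
rewrite -(uncons_rVK z) /uncons_rV; set z0 := z ord0 ord0; set z' := \row_j _.
have z'B : rat_box (l, u) z'.
  by move=> i; have := zB (lift ord0 i); rewrite /= !cons_ratS mxE.
have [t t01 tE] := between_segment _ _ _ (lt_trans bq1 q1z) (lt_trans zq2 q2b).
have -> : z' = t *: z' + (1 - t) *: z' by rewrite -scalerDl addrCA subrr addr0 scale1r.
by rewrite /z0 tE cons_rV_segment; apply: cC => //; [exact: cb1|exact: cb2].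
Qed.

End boundary_step.

(** By induction on the dimension, integrating over the first coordinate: except
    for countably many slices, the interior of a slice of [C] lies in the
    interior of [C], so the slice of the boundary is null by induction. *)
Lemma convex_boundary_null d (C : set 'rV[R]_d) : measurable C -> segment_closed C ->
  leb R d (C `\` rat_interior C) = 0%E.
Proof.
elim: d C => [|d IH] C mC cC.
  have -> : C `\` rat_interior C = set0; last by rewrite measure0.
  apply/seteqP; split => // x [Cx]; case; exists (0, 0); last by case.
  by move=> y _; rewrite (_ : y = x)//; apply/rowP; case.
have mN : measurable (C `\` rat_interior C).
  by apply: measurableD => //; exact: measurable_rat_interior.
rewrite /= /leb_step /pushforward.
pose N := @cons_rV R d @^-1` (C `\` rat_interior C).
have mN' : measurable N by rewrite -[N]setTI; exact: measurable_cons_rV.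
have mfN : measurable_fun setT (leb R d \o xsection N) by exact: measurable_fun_xsection.
rewrite (_ : _ (_ @^-1` _) = \int[lebesgue_measure]_x (leb R d \o xsection N) x)%E//.
rewrite (ae_eq_integral (cst 0%E))//; first by rewrite integral0.
exists (slice_exceptions d C); split.
- by apply: countable_measurable => //; exact: countable_slice_exceptions.
- exact/countable_lebesgue_measure0/countable_slice_exceptions.
move=> a /= na; apply: contrapT => aE; apply: na => _.
pose Ca := [set x | C (cons_rV (a, x))].
have mCa : measurable Ca.
  have mC' : measurable (@cons_rV R d @^-1` C).
    by rewrite -[X in measurable X]setTI; exact: measurable_cons_rV.
  have := measurable_xsection a mC'.
  by rewrite /xsection (_ : [set y | _] = Ca)//; apply/seteqP; split=> x; rewrite /= inE.
have := IH _ mCa (slice_segment_closed _ _ cC a).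
apply: subset_measure0.
- exact: measurable_xsection.
- by apply: measurableD => //; exact: measurable_rat_interior.
- move=> x; rewrite /xsection/= inE => -[Cx nI]; split => // /(rat_interior_slice _ _ cC _ aE).
  exact: nI.
Qed.

Definition corner {d} (x : 'rV[R]_d) (r : R) (s : {ffun 'I_d -> bool}) : 'rV[R]_d :=
  \row_i (x ord0 i + (if s i then r else - r)).

Lemma cornerE {d} (x : 'rV[R]_d) r s i :
  corner x r s ord0 i = x ord0 i + (if s i then r else - r).
Proof. by rewrite mxE. Qed.

Lemma rat_interior_corners {d} (C : set 'rV[R]_d) (x : 'rV[R]_d) :
  rat_interior C x -> exists2 r, 0 < r & forall s, C (corner x r s).
Proof.
move=> [[a b] /= boxC xab].
have [r r0 rP] : exists2 r, 0 < r & forall i,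
    r <= Num.min (x ord0 i - ratr (a ord0 i)) (ratr (b ord0 i) - x ord0 i) / 2.
  apply: finite_lower_bound => i; rewrite divr_gt0// lt_min !subr_gt0.
  exact: xab.
exists r => // s; apply: boxC => i; rewrite cornerE; have := rP i.
have /= := xab i; rewrite ler_pdivlMr// le_min => /andP[h1 h2] /andP[h3 h4].
by case: (s i); apply/andP; split; lra.
Qed.

End convexity.

(** * Log-concave functions *)

Section log_concavity.
Context {R : realType} {d : nat}.
Implicit Types (f : 'rV[R]_d -> R) (x y : 'rV[R]_d).

(** The same notion without logarithms, so without infinite values. *)
Definition logconcave_fun f := (forall x, 0 <= f x) /\
  forall x y (t : R), 0 < t < 1 ->
    f x `^ t * f y `^ (1 - t) <= f (t *: x + (1 - t) *: y).

Lemma logconcave_funP f : log_concave f <-> logconcave_fun f.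
Proof.
split.
- move=> [g [goo cg fg]]; split=> [x|x y t /andP[t0 t1]].
    by rewrite -lee_fin fg expeR_ge0.
  have [fx0|fx0] := eqVneq (f x) 0.
    rewrite fx0 powR0 ?gt_eqF// mul0r -lee_fin fg; exact: expeR_ge0.
  have [fy0|fy0] := eqVneq (f y) 0.
    by rewrite fy0 powR0 ?gt_eqF ?subr_gt0// mulr0 -lee_fin fg expeR_ge0.
  have gfin z : f z != 0 -> exists2 r, g z = r%:E & f z = expR r.
    move=> fz0; have := fg z; have := goo z; case: (g z) => [r| |]//= _.
      by case=> ->; exists r.
    by case=> fz; rewrite fz eqxx in fz0.
  have [rx gx ->] := gfin x fx0; have [ry gy ->] := gfin y fy0.
  rewrite /powR !gt_eqF ?expR_gt0// !expRK -expRD -lee_fin fg.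
  have t01 : 0 <= t <= 1 by rewrite !ltW.
  have := cg x y t t01; rewrite gx gy -!EFinM -EFinD.
  by move=> h; rewrite -[X in (X <= _)%E]/(expeR (t * rx + (1 - t) * ry)%:E) lee_expeR.
- move=> [f0 cf]; exists (fun x => lne (f x)%:E); split.
  + move=> x; rewrite /lne; case: ifPn => // _; exact: ltry.
  + move=> x y t /andP[]; rewrite le_eqVlt => /orP[/eqP <- _|t0].
      by rewrite mul0e add0e subr0 mul1e scale0r add0r scale1r.
    rewrite le_eqVlt => /orP[/eqP ->|t1].
      by rewrite subrr mul0e adde0 mul1e scale0r addr0 scale1r.
    have t1' : 0 < 1 - t by rewrite subr_gt0.
    have [fx0|fx0] := eqVneq (f x) 0.
      by rewrite fx0 lne0 gt0_muleNy// ?lte_fin// addNye leNye.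
    have [fy0|fy0] := eqVneq (f y) 0.
      by rewrite fy0 lne0 gt0_muleNy// ?lte_fin// addeNy leNye.
    have fx : 0 < f x by rewrite lt_neqAle eq_sym fx0 f0.
    have fy : 0 < f y by rewrite lt_neqAle eq_sym fy0 f0.
    have := cf x y t; rewrite t0 t1 => /(_ isT) h.
    have fz : 0 < f (t *: x + (1 - t) *: y).
      by apply: lt_le_trans h; rewrite mulr_gt0 ?powR_gt0.
    rewrite !lne_EFin// -!EFinM -EFinD lee_fin.
    rewrite -ler_expR lnK ?posrE// expRD; apply: le_trans h.
    by rewrite /powR (negPf fx0) (negPf fy0).
  + by move=> x; rewrite lneK //= in_itv/= lee_fin f0 leey.
Qed.

Lemma logconcave_superlevel f q : logconcave_fun f -> 0 <= q ->
  segment_closed [set x | q < f x].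
Proof.
move=> [f0 cf] q0 x y t /= qx qy /andP[]; rewrite le_eqVlt => /orP[/eqP <- _|t0].
  by rewrite subr0 scale0r add0r scale1r.
rewrite le_eqVlt => /orP[/eqP ->|t1].
  by rewrite subrr scale0r addr0 scale1r.
apply: (@lt_le_trans _ _ (f x `^ t * f y `^ (1 - t))); last by apply: cf; rewrite t0.
have t1' : 0 < 1 - t by rewrite subr_gt0.
have [m mq [mx my]] : exists2 m, q < m & m <= f x /\ m <= f y.
  by exists (Num.min (f x) (f y)); rewrite ?lt_min ?qx// !ge_min !lexx orbT.
have m0 : 0 < m by exact: le_lt_trans mq.
apply: (lt_le_trans mq).
have -> : m = m `^ t * m `^ (1 - t).
  rewrite -powRD; last by rewrite (gt_eqF m0) implybT.
  by rewrite addrC subrK powRr1// ltW.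
have [m0' t0' t1''] : [/\ 0 <= m, 0 <= t & 0 <= 1 - t] by rewrite !ltW.
by apply: ler_pM; rewrite ?powR_ge0//; apply: ge0_ler_powR; rewrite ?nnegrE ?f0.
Qed.

End log_concavity.

(** * Compactness *)

(** An ultrafilter finer than the Frechet filter decides every [A i]; picking
    increasing indices that agree with its verdict on the first [n] sets, for
    each [n], is a diagonal argument without nested subsequences. *)
Lemma eventually_decided_subsequence {I : countType} (A : I -> set nat) :
  exists phi : nat -> nat, {homo phi : m n / (m < n)%N} /\
    forall i, (exists N, forall j, (N <= j)%N -> A i (phi j)) \/
              (exists N, forall j, (N <= j)%N -> ~ A i (phi j)).
Proof.
have [U [UU sU]] := ultraFilterLemma (eventually_filter : ProperFilter \oo).
pose B i := if pselect (U (A i)) then A i else ~` A i.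
have UB i : U (B i).
  rewrite /B; case: pselect => // nA.
  by have [] := in_ultra_setVsetC (A i) UU.
pose C n := if unpickle n is Some i then B i else setT.
have UC n : U (C n).
  by rewrite /C; case: unpickle => [i|]; [exact: UB|exact: filterT].
have UCn n : U [set k | forall m, (m <= n)%N -> C m k].
  elim: n => [|n IH].
    by apply: filterS (UC 0%N) => k Ck m; rewrite leqn0 => /eqP ->.
  apply: filterS (filterI IH (UC n.+1)) => k [Ck Ckn] m.
  by rewrite leq_eqVlt => /orP[/eqP ->//|]; rewrite ltnS; exact: Ck.
have /choice[h hP] : forall nm : nat * nat, exists k, (nm.2 < k)%N /\
    forall m, (m <= nm.1)%N -> C m k.
  move=> [n m]; have Um : U [set k | (m < k)%N].
    by apply: sU; exists m.+1.
  by have [k [km Ck]] := filter_ex (filterI Um (UCn n)); exists k.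
pose fix phi n := if n is n'.+1 then h (n, phi n') else h (0%N, 0%N).
have phiS n : (phi n < phi n.+1)%N by have [] := hP (n.+1, phi n).
exists phi; split.
  by apply: homo_ltn => //; exact: ltn_trans.
move=> i.
have ev : exists N, forall j, (N <= j)%N -> B i (phi j).
  exists (pickle i) => -[|j] ij.
    have [_ /(_ (pickle i))] := hP (0%N, 0%N).
    by rewrite /C pickleK; exact.
  have [_ /(_ (pickle i))] := hP (j.+1, phi j).
  by rewrite /C pickleK; exact.
by move: ev; rewrite /B; case: pselect; [left|right].
Qed.

Section compactness.
Context {R : realType} {d : nat}.
Implicit Types (f : nat -> 'rV[R]_d -> R) (x y : 'rV[R]_d).

Definition near_point x (e : R) : set 'rV[R]_d :=
  [set y | forall i, `|y ord0 i - x ord0 i| < e].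

(** The lower limit, in the sense of Kuratowski, of the superlevel sets of the
    [f j].  The point is allowed to move with [j] because a step function is only
    close to the value of [f j] at some other point of the same cell. *)
Definition asymptotic_superlevel f (q : R) : set 'rV[R]_d :=
  [set x | forall e : R, 0 < e ->
    \forall j \near \oo, exists2 y, near_point x e y & q < f j y].

(** Countably many questions about [f j], which determine up to arbitrarily small
    errors whether [f j] exceeds a level close to a given point. *)
Definition rat_probe f (c : 'rV[rat]_d * nat * rat) : set nat :=
  [set j | exists2 y, near_point (map_mx ratr c.1.1) c.1.2.+1%:R^-1 y & ratr c.2 < f j y].

Definition rat_decided f := forall c,
  (\forall j \near \oo, rat_probe f c j) \/ (\forall j \near \oo, ~ rat_probe f c j).

Lemma near_rat_point x (e : R) : 0 < e ->
  exists c : 'rV[rat]_d, near_point (map_mx ratr c) e x.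
Proof.
move=> e0.
have /choice[c cP] : forall i : 'I_d, exists q : rat, `|x ord0 i - ratr q| < e.
  move=> i; have [q] := @rat_in_itvoo R (x ord0 i - e) (x ord0 i + e) ltac:(lra).
  rewrite in_itv/= => /andP[q1 q2]; exists q; rewrite ltr_norml; apply/andP; split; lra.
by exists (\row_i c i) => i; rewrite !mxE.
Qed.

Lemma near_point_trans x y z (e e' : R) :
  near_point x e y -> near_point y e' z -> near_point x (e + e') z.
Proof.
move=> xy yz i; have := xy i; have := yz i => h1 h2.
have -> : z ord0 i - x ord0 i = (z ord0 i - y ord0 i) + (y ord0 i - x ord0 i) by ring.
by apply: le_lt_trans (ler_normD _ _) _; rewrite addrC ltrD.
Qed.

Lemma near_point_sym x y (e : R) : near_point x e y -> near_point y e x.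
Proof. by move=> xy i; rewrite distrC. Qed.

Lemma near_point_le x (e e' : R) : e <= e' -> near_point x e `<=` near_point x e'.
Proof. by move=> ee y xy i; exact: lt_le_trans ee. Qed.

Lemma measurable_near_point x (e : R) : measurable (near_point x e).
Proof.
rewrite (_ : near_point x e = \bigcap_(i in [set: 'I_d])
  ((fun y : 'rV[R]_d => y ord0 i) @^-1` `]x ord0 i - e, x ord0 i + e[)).
  apply: fin_bigcap_measurable => [|i _]; first exact: finite_finset.
  by rewrite -[X in measurable X]setTI; exact: measurable_mx_entry.
have E (a b : R) : (`|a - b| < e) = (b - e < a < b + e).
  by rewrite ltr_norml; apply/andP/andP => -[]; split; lra.
apply/seteqP; split => y xy i.
  by move=> _; have := xy i; rewrite /= in_itv/= E.
by have := xy i Logic.I; rewrite /= in_itv/= E.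
Qed.

Lemma rat_decided_subsequence f :
  exists2 phi : nat -> nat, {homo phi : m n / (m < n)%N} & rat_decided (f \o phi).
Proof.
have [phi [phiS H]] := eventually_decided_subsequence (rat_probe f).
exists phi => // c; have [[N HN]|[N HN]] := H c; [left|right]; exists N => //.
Qed.

Section decided.
Variables (f : nat -> 'rV[R]_d -> R).
Hypotheses (lf : forall j, logconcave_fun (f j)) (decf : rat_decided f).

(** For a decided sequence, what happens infinitely often happens eventually. *)
Lemma frequent_asymptotic_superlevel x (q : rat) :
  (forall e : R, 0 < e -> forall N, exists2 j, (N <= j)%N &
     exists2 y, near_point x e y & ratr q < f j y) ->
  asymptotic_superlevel f (ratr q) x.
Proof.
move=> H e e0.
have e4 : 0 < e / 2 by rewrite divr_gt0.
have [n [h nh /andP[h0 he]]] := small_inv _ e4.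
have n0 : 0 < h / 2 by rewrite divr_gt0.
have [c xc] := near_rat_point x _ n0.
have [ev|ev] := decf (c, n, q).
  apply: filterS ev => j [y /= cy qy]; exists y => //.
  have := near_point_trans _ _ _ _ _ (near_point_sym _ _ _ xc) cy.
  by rewrite nh; apply: near_point_le; lra.
have [N _ HN] := ev; have [j Nj [y xy qy]] := H _ n0 N.
exfalso; apply: (HN j Nj); exists y => //=.
have := near_point_trans _ _ _ _ _ xc xy.
by rewrite nh; apply: near_point_le; lra.
Qed.

Lemma measurable_asymptotic_superlevel (q : rat) :
  measurable (asymptotic_superlevel f (ratr q)).
Proof.
have -> : asymptotic_superlevel f (ratr q) = \bigcap_(n in [set: nat])
    \bigcup_(c in [set c | \forall j \near \oo, rat_probe f (c, n, q) j])
      near_point (map_mx ratr c) (n.+1%:R^-1 / 2).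
  apply/seteqP; split => x.
    move=> Hx n _; have n0 : 0 < (n.+1%:R^-1 / 2 : R) by rewrite divr_gt0.
    have [c xc] := near_rat_point x _ n0; exists c => //=.
    apply: filterS (Hx _ n0) => j [y xy qy]; exists y => //=.
    have := near_point_trans _ _ _ _ _ xc xy.
    by apply: near_point_le; rewrite -splitr.
  move=> Hx e e0; have e4 : 0 < e / 2 by rewrite divr_gt0.
  have [n [h nh /andP[h0 he]]] := small_inv _ e4.
  have [c /= ev xc] := Hx n Logic.I.
  apply: filterS ev => j [y /= cy qy]; exists y => //.
  have := near_point_trans _ _ _ _ _ (near_point_sym _ _ _ xc) cy.
  by rewrite nh; apply: near_point_le; lra.
apply: bigcapT_measurable => n; apply: countable_bigcup_measurable => c _.
exact: measurable_near_point.
Qed.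

Definition asymptotic_support : set 'rV[R]_d :=
  \bigcup_(q in [set q : rat | 0 < q]) asymptotic_superlevel f (ratr q).

Lemma asymptotic_superlevel_segment q : 0 <= q ->
  segment_closed (asymptotic_superlevel f q).
Proof.
move=> q0 x y t Hx Hy t01 e e0.
apply: filterS2 (Hx _ e0) (Hy _ e0) => j [x' xx' qx'] [y' yy' qy'].
exists (t *: x' + (1 - t) *: y'); last first.
  exact: logconcave_superlevel (lf j) q0 _ _ _ qx' qy' t01.
move=> i; rewrite !mxE; have := xx' i; have := yy' i.
move/andP: t01 => [t0 t1].
have t1' : 0 <= 1 - t by rewrite subr_ge0.
set u := x' ord0 i - _; set v := y' ord0 i - _ => hv hu.
have -> : t * x' ord0 i + (1 - t) * y' ord0 i - (t * x ord0 i + (1 - t) * y ord0 i)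
  = t * u + (1 - t) * v by rewrite /u /v; ring.
have [m /andP[um vm] me] : exists2 m, (`|u| <= m) && (`|v| <= m) & m < e.
  by exists (Num.max `|u| `|v|); rewrite ?gt_max ?hu// !le_max !lexx orbT.
apply: le_lt_trans me; apply: le_trans (ler_normD _ _) _.
rewrite !normrM (ger0_norm t0) (ger0_norm t1').
have := ler_wpM2l t0 um; have := ler_wpM2l t1' vm; lra.
Qed.

Lemma asymptotic_superlevelS q q' : q <= q' ->
  asymptotic_superlevel f q' `<=` asymptotic_superlevel f q.
Proof.
move=> qq' x Hx e e0; apply: filterS (Hx e e0) => j [y xy qy].
by exists y => //; exact: le_lt_trans qy.
Qed.

Lemma asymptotic_support_segment : segment_closed asymptotic_support.
Proof.
move=> x y t [q /= q0 Hx] [r /= r0 Hy] t01.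
exists (Num.min q r) => /=; first by rewrite lt_min q0.
have qr0 : 0 <= ratr (Num.min q r) :> R by rewrite ler0q le_min !ltW.
apply: asymptotic_superlevel_segment => //.
- by apply: asymptotic_superlevelS Hx; rewrite ler_rat ge_min lexx.
- by apply: asymptotic_superlevelS Hy; rewrite ler_rat ge_min lexx orbT.
Qed.

(** Around [x] there are corners of a cube in the support, and near each corner
    there is a point where [f j] is above a fixed positive level.  These points
    move with [j], but they stay in the orthants at any [y] close to [x], so the
    superlevel set of [f j], which is convex, contains [y]. *)
Lemma eventually_bounded_below x : rat_interior asymptotic_support x ->
  exists2 rc : R * R, 0 < rc.1 /\ 0 < rc.2 &
    \forall j \near \oo, forall y, near_point x rc.1 y -> rc.2 < f j y.
Proof.
move=> xC.
have [r r0 vC] := rat_interior_corners _ _ xC; set v := corner x r in vC.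
have /choice[q qP] : forall s, exists q : rat, 0 < q /\ asymptotic_superlevel f (ratr q) (v s).
  by move=> s; have [q q0 Hq] := vC s; exists q.
have [c c0 cP] : exists2 c : R, 0 < c & forall s, c <= ratr (q s).
  by apply: finite_lower_bound => s; rewrite ltr0q; case: (qP s).
exists (r / 2, c) => /=; first by split => //; rewrite divr_gt0.
have r20 : 0 < r / 2 by rewrite divr_gt0.
have : \forall j \near \oo, forall s,
    exists2 y, near_point (v s) (r / 2) y & ratr (q s) < f j y.
  by apply: filter_forall => s; have [_ /(_ _ r20)] := qP s.
apply: filterS => j Hj y xy.
apply: (orthants_meet_convex [set z | c < f j z]).
  by apply: logconcave_superlevel => //; exact: ltW.
move=> s; have [z vz qz] := Hj (finfun s); exists z => /=.
  exact: le_lt_trans (cP _) qz.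
move=> i; have := vz i; have := xy i; rewrite cornerE ffunE !ltr_norml.
by case: (s i) => /andP[h1 h2] /andP[h3 h4]; lra.
Qed.

(** Only points [y] near [x] are known to satisfy [f j y > s].  Prolonging the
    segment from [y] through [x] to a point [z] still within the cube where
    [f j] exceeds [c], log-concavity transfers the value at [y] to [x], with a
    weight [t] on [y] that is as close to [1] as desired if [y] is close enough
    to [x]. *)
Lemma asymptotic_superlevel_liminf x (s s' : R) : 0 <= s' -> s' < s ->
  rat_interior asymptotic_support x -> asymptotic_superlevel f s x ->
  \forall j \near \oo, s' < f j x.
Proof.
move=> s'0 s's xC xs; have s0 : 0 < s by exact: le_lt_trans s's.
have [[r c]/= [r0 c0] Hc] := eventually_bounded_below x xC.
have [t /andP[t0 t1] Ht] := powR_weight s c s' c0 s'0 s's.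
have t1' : 0 < 1 - t by rewrite subr_gt0.
have e0 : 0 < r * (1 - t) by rewrite mulr_gt0.
apply: filterS2 Hc (xs _ e0) => j Hj [y xy sy].
pose z := (1 - t)^-1 *: (x - t *: y).
have xE : x = t *: y + (1 - t) *: z.
  by rewrite scalerA divff ?gt_eqF// scale1r addrCA subrr addr0.
have xz : near_point x r z.
  move=> i; have := xy i; rewrite !mxE.
  have -> : (1 - t)^-1 * (x ord0 i + - (t * y ord0 i)) - x ord0 i =
    - (t * (1 - t)^-1 * (y ord0 i - x ord0 i)).
    by field; rewrite gt_eqF.
  rewrite normrN !normrM (ger0_norm (ltW t0)) gtr0_norm ?invr_gt0// => yx.
  rewrite mulrAC ltr_pdivrMr//; apply: le_lt_trans yx.
  by rewrite ler_piMl// ltW.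
apply: (lt_le_trans Ht).
have [_ cf] := lf j; rewrite {1}xE.
apply: le_trans (cf y z t _); last by rewrite t0.
have fj0 w : 0 <= f j w by have [->] := lf j.
have cz : c <= f j z by apply/ltW/Hj.
by apply: ler_pM; rewrite ?powR_ge0//; apply: ge0_ler_powR; rewrite ?nnegrE ?fj0// ltW.
Qed.

End decided.

(** The upper bounds [U j] are only compared with values of [f j] at nearby
    points, which is what step functions on a grid provide.  The conclusion
    fails at most on the boundary of the support, which is null because the
    support is convex; off the support the upper limit of [U (phi j) x] is at
    most [0]. *)
Theorem logconcave_compactness f (U : nat -> 'rV[R]_d -> R) :
  (forall j, logconcave_fun (f j)) ->
  (forall x e, 0 < e ->
    \forall j \near \oo, exists2 y, near_point x e y & U j x <= f j y + e) ->
  exists2 phi : nat -> nat, {homo phi : m n / (m < n)%N} &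
    {ae leb R d, forall x, forall s s' : R, s' < s ->
      (forall N, exists2 j, (N <= j)%N & s < U (phi j) x) ->
      \forall j \near \oo, s' < f (phi j) x}.
Proof.
move=> lf fU; have [phi phiS dec] := rat_decided_subsequence f.
exists phi => //; pose g := f \o phi.
have lg j : logconcave_fun (g j) by exact: lf.
have phi_ge j : (j <= phi j)%N.
  by elim: j => // j IH; apply: leq_ltn_trans IH _; exact: phiS.
have mC : measurable (asymptotic_support g).
  by apply: countable_bigcup_measurable => q _; exact: measurable_asymptotic_superlevel.
exists (asymptotic_support g `\` rat_interior (asymptotic_support g)); split.
- by apply: measurableD => //; exact: measurable_rat_interior.
- by apply: convex_boundary_null => //; exact: asymptotic_support_segment.
move=> x /= nx; apply: contrapT => xC; apply: nx => s s' s's Us.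
have [s'0|s'0] := ltP s' 0.
  by apply: nearW => j; have [g0 _] := lg j; exact: lt_le_trans (g0 _).
have [q] := rat_in_itvoo s's; rewrite in_itv/= => /andP[s'q qs].
have q0 : 0 < q by rewrite -(ltr0q R); exact: le_lt_trans s'q.
have gq : asymptotic_superlevel g (ratr q) x.
  apply: frequent_asymptotic_superlevel => // e e0 N.
  have e'0 : 0 < Num.min e (s - ratr q) by rewrite lt_min e0 subr_gt0.
  have [N' _ HN'] := fU x _ e'0.
  have [j Nj Uj] := Us (maxn N N').
  exists j; first by apply: leq_trans Nj; exact: leq_maxl.
  have [|y xy Uy] := HN' (phi j).
    by apply: leq_trans (phi_ge j); apply: leq_trans Nj; exact: leq_maxr.
  exists y; first by apply: near_point_le xy; rewrite ge_min lexx.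
  have : Num.min e (s - ratr q) <= s - ratr q by rewrite ge_min lexx orbT.
  rewrite /g/=; lra.
apply: (asymptotic_superlevel_liminf g lg x (ratr q) s') => //.
apply: contrapT => xi; apply: xC; split => //; exists q => //.
Qed.

End compactness.

(** * Stability of log-concavity *)

Section liminf_logconcave.
Context {R : realType} {d : nat}.

Lemma logconcave_limn_einf (f : nat -> 'rV[R]_d -> R) (l : 'rV[R]_d -> R) :
  (forall j, logconcave_fun (f j)) ->
  (forall x, limn_einf (fun j => (f j x)%:E) = (l x)%:E) -> logconcave_fun l.
Proof.
move=> lf lE; have l0 x : 0 <= l x.
  rewrite -lee_fin -lE; apply: limn_einf_ge; apply: nearW => j.
  by rewrite lee_fin; have [->] := lf j.
split=> // x y t /[dup] t01 /andP[t0 t1].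
have t1' : 0 < 1 - t by rewrite subr_gt0.
have [->|lx0] := eqVneq (l x) 0; first by rewrite powR0 ?gt_eqF// mul0r.
have [->|ly0] := eqVneq (l y) 0; first by rewrite powR0 ?gt_eqF// mulr0.
have lx : 0 < l x by rewrite lt_neqAle eq_sym lx0 l0.
have ly : 0 < l y by rewrite lt_neqAle eq_sym ly0 l0.
set c := l x `^ t * l y `^ (1 - t).
have c0 : 0 <= c by rewrite mulr_ge0 ?powR_ge0.
(* f j is eventually above (1 - e) l at x and y, and the factor 1 - e passes
   through the geometric mean. *)
suff H e : 0 < e -> e < 1 -> (1 - e) * c <= l (t *: x + (1 - t) *: y).
  apply/ler_addgt0Pr => e e0.
  pose e' := Num.min (1 / 2) (e / (c + 1)).
  have c1 : 0 < c + 1 by lra.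
  have e'0 : 0 < e' by rewrite lt_min divr_gt0//= divr_gt0.
  have e'1 : e' < 1 by rewrite gt_min; apply/orP; left; lra.
  have e'e : e' * (c + 1) <= e by rewrite -ler_pdivlMr// ge_min lexx orbT.
  by have := H e' e'0 e'1; nra.
move=> e0 e1; have e1' : 0 < 1 - e by rewrite subr_gt0.
have -> : (1 - e) * c = ((1 - e) * l x) `^ t * ((1 - e) * l y) `^ (1 - t).
  rewrite !powRM ?(ltW e1') ?l0// mulrACA -powRD; last by rewrite (gt_eqF e1') implybT.
  by rewrite (addrC t) subrK powRr1// ltW.
rewrite -lee_fin -lE; apply: limn_einf_ge.
have small z : 0 < l z -> \forall j \near \oo, (1 - e) * l z <= f j z.
  move=> lz; have : (((1 - e) * l z)%:E < limn_einf (fun j => (f j z)%:E))%E.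
    by rewrite lE lte_fin gtr_pMl// gtrBl.
  by move/limn_einf_gt; apply: filterS => j; rewrite lte_fin => /ltW.
apply: filterS2 (small x lx) (small y ly) => j hx hy; rewrite lee_fin.
have [f0 cf] := lf j; apply: le_trans (cf x y t t01).
by apply: ler_pM; rewrite ?powR_ge0//; apply: ge0_ler_powR;
  rewrite ?nnegrE ?mulr_ge0 ?(ltW e1') ?l0 ?f0 ?(ltW t0) ?(ltW t1').
Qed.

Lemma logconcave_powR (f : 'rV[R]_d -> R) (s : R) : 0 <= s ->
  logconcave_fun f -> logconcave_fun (fun x => f x `^ s).
Proof.
move=> s0 [f0 cf]; split=> [x|x y t t01]; first exact: powR_ge0.
rewrite -!powRrM (mulrC s t) (mulrC s (1 - t)) !powRrM -powRM ?powR_ge0//.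
by apply: ge0_ler_powR; rewrite ?nnegrE ?mulr_ge0 ?powR_ge0 ?f0//; exact: cf.
Qed.

Lemma logconcave_scale (f : 'rV[R]_d -> R) (c : R) : 0 <= c ->
  logconcave_fun f -> logconcave_fun (fun x => c * f x).
Proof.
rewrite le_eqVlt => /orP[/eqP <-|c0] [f0 cf].
  split=> [x|x y t /andP[t0 t1]]; first by rewrite mul0r.
  by rewrite !mul0r powR0 ?gt_eqF// mul0r.
split=> [x|x y t t01]; first by rewrite mulr_ge0 ?f0 // ltW.
have c0' := ltW c0.
rewrite !powRM ?f0// mulrACA -powRD; last by rewrite (gt_eqF c0) implybT.
by rewrite (addrC t) subrK powRr1// ler_wpM2l//; exact: cf.
Qed.

Lemma logconcave_min (f : 'rV[R]_d -> R) (c : R) : 0 <= c ->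
  logconcave_fun f -> logconcave_fun (fun x => Num.min (f x) c).
Proof.
move=> c0 [f0 cf]; have m0 x : 0 <= Num.min (f x) c by rewrite le_min f0.
split=> // x y t /[dup] t01 /andP[t0 t1].
have t1' : 0 < 1 - t by rewrite subr_gt0.
rewrite le_min; apply/andP; split.
  apply: le_trans (cf x y t t01).
  by apply: ler_pM; rewrite ?powR_ge0//; apply: ge0_ler_powR;
    rewrite ?nnegrE ?m0 ?f0 ?ge_min ?lexx// ltW.
have [->|cn0] := eqVneq c 0.
  by rewrite (min_idPr (f0 x)) powR0 ?gt_eqF// mul0r.
rewrite [leRHS](_ : _ = c `^ t * c `^ (1 - t)); last first.
  rewrite -powRD; last by rewrite cn0 implybT.
  by rewrite (addrC t) subrK powRr1.
by apply: ler_pM; rewrite ?powR_ge0//; apply: ge0_ler_powR;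
  rewrite ?nnegrE ?m0 ?c0 ?ge_min ?lexx ?orbT// ltW.
Qed.

End liminf_logconcave.

(** * Step functions above a bounded function *)

Section brackets.
Context {R : realType} {d : nat}.
Implicit Types (f : 'rV[R]_d -> R) (x y : 'rV[R]_d).

(** The grid points are the [m / (k + 1) - k] for [m < grid_size k]: they have
    spacing [1 / (k + 1)] and cover the interval from [-k] to [k].  A cell is
    given by the outcomes of all comparisons of coordinates with grid points, so
    the cells cover the whole space and the outer ones are unbounded. *)
Definition grid_size k := (2 * k * k.+1).+1.

Definition cell k x : {ffun 'I_d * 'I_(grid_size k) -> bool} :=
  [ffun im : 'I_d * 'I_(grid_size k) => im.2%:R <= k.+1%:R * (x ord0 im.1 + k%:R)].

Lemma measurable_cell k z : measurable [set x | cell k x = z].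
Proof.
rewrite (_ : [set x | cell k x = z] = \bigcap_(im in [set: 'I_d * 'I_(grid_size k)]%type)
  ((fun x : 'rV[R]_d => x ord0 im.1) @^-1`
    (if z im then `[im.2%:R / k.+1%:R - k%:R, +oo[%classic
     else `]-oo, im.2%:R / k.+1%:R - k%:R[%classic))).
  apply: fin_bigcap_measurable => [|im _]; first exact: finite_finset.
  rewrite -[X in measurable X]setTI; apply: measurable_mx_entry => //.
  by case: (z im).
have E (m : nat) (u : R) : (m%:R <= k.+1%:R * (u + k%:R)) = (m%:R / k.+1%:R - k%:R <= u).
  by rewrite lerBlDr ler_pdivrMr// mulrC.
apply/seteqP; split => x.
  by move=> /= <- im _ /=; rewrite ffunE E; case: ifPn; rewrite /= in_itv/= ?andbT// ltNge.
move=> xz; apply/ffunP => im; rewrite ffunE E; have := xz im Logic.I.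
by case: (z im) => /=; rewrite in_itv/= ?andbT// ltNge => /negPf.
Qed.

Lemma near_cell k x y : near_point 0 k%:R x -> cell k x = cell k y ->
  near_point x k.+1%:R^-1 y.
Proof.
move=> xk xy i; have := xk i; rewrite mxE subr0 ltr_norml => /andP[x1 x2].
pose g (u : R) := k.+1%:R * (u + k%:R).
have k0 : 0 < k.+1%:R :> R by [].
have g0 : 0 <= g (x ord0 i) by rewrite mulr_ge0//; lra.
have bit m : (m < grid_size k)%N -> (m%:R <= g (x ord0 i)) = (m%:R <= g (y ord0 i)).
  by move=> mk; have /ffunP/(_ (i, Ordinal mk)) := xy; rewrite !ffunE.
pose n := Num.truncn (g (x ord0 i)).
have /andP[nx xn] : n%:R <= g (x ord0 i) < n.+1%:R by exact: truncn_itv.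
have nk : (n.+1 < grid_size k)%N.
  rewrite /grid_size ltnS -(ltr_nat R); apply: le_lt_trans nx _.
  rewrite /g natrM natrM [_ * k.+1%:R]mulrC ltr_pM2l//.
  by rewrite mulrC mulr_natr mulr2n; lra.
have yn : n%:R <= g (y ord0 i) by rewrite -bit// ltnW.
have yn1 : g (y ord0 i) < n.+1%:R by rewrite ltNge -bit// -ltNge.
have : `|g (y ord0 i) - g (x ord0 i)| < 1.
  move: xn yn1; rewrite -natr1 ltr_norml => xn yn1; apply/andP; split; lra.
rewrite /g -mulrBr opprD addrACA subrr addr0 normrM gtr0_norm//.
by rewrite -ltr_pdivlMl// mulr1.
Qed.

Definition step_bracket k (b : {ffun {ffun 'I_d * 'I_(grid_size k) -> bool} -> nat}) x : R :=
  (b (cell k x))%:R / k.+1%:R.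

Lemma measurable_step_bracket k b : measurable_fun setT (step_bracket k b).
Proof.
rewrite (_ : step_bracket k b = fun x =>
    \sum_z (b z)%:R / k.+1%:R * \1_[set x | cell k x = z] x).
  apply: measurable_sum => z; apply: measurable_funM => //.
  by apply: measurable_indic; exact: measurable_cell.
apply/funext => x; rewrite (bigD1 (cell k x))//= indicE mem_set// mulr1.
rewrite big1 ?addr0// => z zx; rewrite indicE memNset ?mulr0//= => xz.
by rewrite xz eqxx in zx.
Qed.

(** The value on each cell is the least multiple of [1 / (k + 1)] above [f], so
    there are finitely many candidates for the step function.  By minimality [f]
    almost attains the value within the cell. *)
Lemma step_bracket_exists k (M : nat) f : (forall x, 0 <= f x <= M%:R) ->
  exists b : {ffun {ffun 'I_d * 'I_(grid_size k) -> bool} -> 'I_(k.+1 * M).+1},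
    let U := step_bracket k [ffun z => b z : nat] in
    [/\ forall x, f x <= U x, forall x, 0 <= U x <= M%:R &
      forall x, exists2 y, cell k x = cell k y & U x <= f y + k.+1%:R^-1].
Proof.
move=> fM; pose P z (j : nat) := `[< forall y, cell k y = z -> f y <= j%:R / k.+1%:R >].
have k0 : 0 < k.+1%:R :> R by [].
have PM z : P z (k.+1 * M)%N.
  apply/asboolP => y _; rewrite natrM mulrC mulrA mulVf ?gt_eqF// mul1r.
  by case/andP: (fM y).
have exP z : exists j, P z j by exists (k.+1 * M)%N.
have bM z : (ex_minn (exP z) < (k.+1 * M).+1)%N.
  by rewrite ltnS; case: ex_minnP => j _; apply.
exists [ffun z => Ordinal (bM z)]; split => x.
- rewrite /step_bracket !ffunE /=; case: ex_minnP => j /asboolP Pj _.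
  exact: Pj.
- rewrite /step_bracket !ffunE /= divr_ge0//= ler_pdivrMr// -natrM ler_nat.
  by rewrite mulnC -ltnS.
- rewrite /step_bracket !ffunE /=; case: ex_minnP => -[|j] Pj minj.
    by exists x => //; rewrite mul0r addr_ge0//; case/andP: (fM x).
  have : ~ (forall y, cell k y = cell k x -> f y <= j%:R / k.+1%:R).
    by move=> /asboolP/minj; rewrite ltnn.
  rewrite -existsNP => -[y /not_implyP[yx /negP]]; rewrite -ltNge => fy.
  exists y => //; rewrite -natr1 mulrDl mul1r.
  by move: fy; set h := k.+1%:R^-1; lra.
Qed.

End brackets.

(** * Small powers and entropy *)

Section entropy_limit.
Local Open Scope ereal_scope.
Context {R : realType} {d : nat} (p : 'rV[R]_d -> R) (Dp : D R d p).
Variables (v : 'rV[R]_d -> R) (lam0 : R) (M : nat).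
Hypotheses (mv : measurable_fun setT v) (v0 : forall x, (0 <= v x)%R)
  (lam00 : (0 < lam0)%R)
  (pv : \int[leb R d]_x (p x * v x `^ lam0)%:E < +oo).

(** Its integral is the divergence from [p] to [l] if [v] is the inverse of
    [p].  The other use has [v = 1], where it is a cross entropy. *)
Definition weighted_entropy (l : 'rV[R]_d -> R) x : \bar R :=
  (p x)%:E * - lne (l x * v x)%:E.

(** Let [h j = ((V j * v) `^ mu j - 1) / mu j].  The lower bound on the moments
    gives that the integral of [p * h j] is at least [- a], the functions [h j]
    have the common majorant [Df = (M * v) `^ lam0 / lam0], and the upper limit
    of [h j] is at most the logarithm of [l * v].  Fatou's lemma applies to the
    nonnegative functions [p * (Df - h j)]. *)
Lemma weighted_entropy_limit (V : nat -> 'rV[R]_d -> R) (mu : nat -> R)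
    (l : 'rV[R]_d -> R) (a : R) :
  (forall j, measurable_fun setT (V j)) ->
  (forall j x, (0 <= V j x <= M%:R)%R) ->
  (forall j, (0 < mu j <= lam0)%R) -> mu j @[j --> \oo] --> (0 : R)%R ->
  measurable_fun setT l -> (forall x, (0 <= l x <= M%:R)%R) ->
  {ae leb R d, forall x, forall s, (l x < s)%R -> \forall j \near \oo, (V j x <= s)%R} ->
  (forall j, (expR (- mu j * a))%:E <=
     \int[leb R d]_x (p x * (V j x * v x) `^ mu j)%:E) ->
  (leb R d).-integrable setT (weighted_entropy l) /\
  \int[leb R d]_x weighted_entropy l x <= a%:E.
Proof.
move=> mV VM mu0 mucvg ml lM Vl Va.
have [mp p0 p1] := Dp.
pose Df x := ((M%:R * v x) `^ lam0 / lam0)%R.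
pose h j x := (((V j x * v x) `^ mu j - 1) / mu j)%R.
have Df0 x : (0 <= Df x)%R by rewrite divr_ge0 ?powR_ge0// ltW.
have hD j x : (h j x <= Df x)%R.
  have /andP[mj0 mjl] := mu0 j; have /andP[V0 VMx] := VM j x.
  apply: (le_trans (box_cox_le _ _ _ (mulr_ge0 V0 (v0 x)) mj0 mjl)).
  rewrite /Df; apply: ler_wpM2r; first by rewrite invr_ge0 ltW.
  apply: (@le_trans _ _ ((V j x * v x) `^ lam0)%R).
    by rewrite gerBl.
  by apply: ge0_ler_powR; rewrite ?nnegrE ?mulr_ge0 ?ler_wpM2r// ltW.
pose F j x := (p x * (Df x - h j x))%:E.
have mpow (g : 'rV[R]_d -> R) (t : R) : measurable_fun setT g ->
    measurable_fun setT (fun x => g x `^ t)%R.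
  by move=> mg; exact: (measurableT_comp (measurable_powR t) mg).
have mDf : measurable_fun setT Df.
  by apply: measurable_funM => //; apply: mpow; apply: measurable_funM.
have mVv j : measurable_fun setT (fun x => (V j x * v x) `^ mu j)%R.
  by apply: mpow; apply: measurable_funM.
have mh j : measurable_fun setT (h j).
  by apply: measurable_funM => //; apply: measurable_funB.
have F0 j x : 0 <= F j x by rewrite lee_fin mulr_ge0// subr_ge0.
have mF j : measurable_fun setT (F j).
  by apply/measurable_EFinP; apply: measurable_funM => //; apply: measurable_funB.
pose ID := \int[leb R d]_x (p x * Df x)%:E.
have ID0 : 0 <= ID by apply: integral_ge0 => x _; rewrite lee_fin mulr_ge0.
have IDoo : ID < +oo.
  rewrite /ID (eq_integral (fun x => (M%:R `^ lam0 / lam0)%:E * (p x * v x `^ lam0)%:E)).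
    rewrite ge0_integralZl//.
    - by rewrite lte_mul_pinfty// lee_fin divr_ge0 ?powR_ge0// ltW.
    - by apply/measurable_EFinP; apply: measurable_funM => //; exact: mpow.
    - by move=> x _; rewrite lee_fin mulr_ge0// powR_ge0.
    - by rewrite lee_fin divr_ge0 ?powR_ge0// ltW.
  by move=> x _; rewrite -EFinM /Df powRM//; congr EFin; ring.
have IF j : \int[leb R d]_x F j x <= ID + a%:E.
  have /andP[mj0 mjl] := mu0 j.
  have psi0 x : 0 <= (p x * (V j x * v x) `^ mu j / mu j)%:E.
    by rewrite lee_fin divr_ge0 ?mulr_ge0 ?powR_ge0// ltW.
  (* Integrals of nonnegative functions are added, so that no integrability of
     h j has to be known. *)
  have E : \int[leb R d]_x F j x + \int[leb R d]_x (p x * (V j x * v x) `^ mu j / mu j)%:E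
      = ID + ((mu j)^-1)%:E.
    rewrite -ge0_integralD//; last first.
      by apply/measurable_EFinP; do 2 apply: measurable_funM => //.
    transitivity (\int[leb R d]_x ((p x * Df x)%:E + ((mu j)^-1)%:E * (p x)%:E)).
      apply: eq_integral => x _; rewrite -EFinM -!EFinD /F /h; congr EFin; ring.
    rewrite ge0_integralD//.
    - rewrite ge0_integralZl// ?p1 ?mule1//; first exact/measurable_EFinP.
      - by move=> x _; rewrite lee_fin.
      - by rewrite lee_fin invr_ge0 ltW.
    - by move=> x _; rewrite lee_fin mulr_ge0.
    - by apply/measurable_EFinP; exact: measurable_funM.
    - by move=> x _; rewrite lee_fin mulr_ge0// invr_ge0 ltW.
    - by apply: emeasurable_funM => //; exact/measurable_EFinP.
  have Eoo : \int[leb R d]_x F j x +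
      \int[leb R d]_x (p x * (V j x * v x) `^ mu j / mu j)%:E < +oo.
    by rewrite E lte_add_pinfty// ltry.
  have IF0 : 0 <= \int[leb R d]_x F j x by exact: integral_ge0.
  have psi_ge : ((1 - mu j * a) / mu j)%:E <=
      \int[leb R d]_x (p x * (V j x * v x) `^ mu j / mu j)%:E.
    rewrite (eq_integral (fun x => ((mu j)^-1)%:E * (p x * (V j x * v x) `^ mu j)%:E)).
      rewrite ge0_integralZl//.
      - rewrite mulrC EFinM; apply: lee_wpmul2l; first by rewrite lee_fin invr_ge0 ltW.
        apply: le_trans (Va j); rewrite lee_fin.
        by have := expR_ge1Dx (- mu j * a); rewrite mulNr.
      - by apply/measurable_EFinP; apply: measurable_funM.
      - by move=> x _; rewrite lee_fin mulr_ge0// powR_ge0.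
      - by rewrite lee_fin invr_ge0 ltW.
    by move=> x _; rewrite -EFinM mulrC.
  have IFfin : \int[leb R d]_x F j x = (fine (\int[leb R d]_x F j x))%:E.
    rewrite fineK// ge0_fin_numE//; apply: le_lt_trans Eoo.
    by rewrite leeDl// integral_ge0.
  have IDfin : ID = (fine ID)%:E by rewrite fineK// ge0_fin_numE.
  have := leeD2l (\int[leb R d]_x F j x) psi_ge.
  rewrite E IFfin IDfin -!EFinD !lee_fin.
  rewrite mulrBl mul1r (mulrC (mu j)) mulfK ?gt_eqF//; lra.
pose G x := (p x * Df x)%:E + weighted_entropy l x.
have mW : measurable_fun setT (weighted_entropy l).
  apply: emeasurable_funM; first exact/measurable_EFinP.
  apply: measurableT_comp => //; apply: measurable_lne_EFin.
  exact: measurable_funM.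
have y0 x : (0 <= l x * v x)%R by rewrite mulr_ge0//; case/andP: (lM x).
have mG : measurable_fun setT G.
  apply: emeasurable_funD => //; apply/measurable_EFinP; exact: measurable_funM.
have lD x r : (expR r <= l x * v x)%R -> (r <= Df x)%R.
  move=> ry; rewrite /Df ler_pdivlMr//.
  have lMx : (l x * v x <= M%:R * v x)%R by rewrite ler_wpM2r//; case/andP: (lM x).
  have : (expR (r * lam0) <= (M%:R * v x) `^ lam0)%R.
    have -> : (expR (r * lam0) = expR r `^ lam0)%R.
      by rewrite /powR gt_eqF ?expR_gt0// expRK mulrC.
    by apply: ge0_ler_powR; rewrite ?nnegrE ?expR_ge0 ?mulr_ge0 ?(le_trans ry)// ltW.
  by have := expR_ge1Dx (r * lam0); lra.
have GE x : (0 < l x * v x)%R -> G x = (p x * (Df x - ln (l x * v x)))%:E.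
  by move=> yx; rewrite /G /weighted_entropy lne_EFin// -EFinN -EFinM -EFinD mulrBr mulrN.
have G0 x : 0 <= G x.
  have := y0 x; rewrite le_eqVlt => /orP[/eqP yx|yx].
    rewrite /G /weighted_entropy -yx lne0; apply: adde_ge0; first by rewrite lee_fin mulr_ge0.
    by apply: mule_ge0; rewrite ?lee_fin.
  by rewrite GE// lee_fin mulr_ge0// subr_ge0; apply: lD; rewrite lnK.
have GF : {ae leb R d, forall x, G x <= limn_einf (F^~ x)}.
  apply: filterS Vl => x Vx.
  (* r stands for a number above the logarithm of l x * v x. *)
  have key r : (l x * v x < expR r)%R -> (p x * (Df x - r))%:E <= limn_einf (F^~ x).
    move=> yr.
    have [r' r'r yr'] : exists2 r', (r' < r)%R & (l x * v x < expR r')%R.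
      have := y0 x; rewrite le_eqVlt => /orP[/eqP <-|yx].
        by exists (r - 1)%R; [rewrite gtrBl|exact: expR_gt0].
      have lr : (ln (l x * v x) < r)%R by rewrite -ltr_expR lnK.
      exists ((ln (l x * v x) + r) / 2)%R; first lra.
      by rewrite -[X in (X < _)%R]lnK ?posrE// ltr_expR; lra.
    have [s ls sr] : exists2 s, (l x < s)%R & (s * v x <= expR r')%R.
      have := v0 x; rewrite le_eqVlt => /orP[/eqP vx|vx].
        by exists (l x + 1)%R; [rewrite ltrDl|rewrite -vx mulr0 expR_ge0].
      exists (expR r' / v x)%R; first by rewrite ltr_pdivlMr.
      by rewrite divfK// gt_eqF.
    apply: limn_einf_ge; apply: filterS2 (Vx s ls) (near_mul_expR_lt r r' mu r'r mucvg).
    move=> j Vs rj; rewrite lee_fin ler_wpM2l// lerB//.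
    have /andP[mj0 _] := mu0 j; have /andP[V0 _] := VM j x.
    apply: le_trans (ltW rj); apply: box_cox_le_log => //; first by rewrite mulr_ge0.
    by apply: le_trans sr; rewrite ler_wpM2r.
  have := p0 x; rewrite le_eqVlt => /orP[/eqP px|px].
    rewrite /G /weighted_entropy -px mul0r !mul0e adde0.
    by apply: limn_einf_ge; apply: nearW => j; exact: F0.
  have := y0 x; rewrite le_eqVlt => /orP[/eqP yx|yx].
    suff -> : limn_einf (F^~ x) = +oo by exact: leey.
    have : 0 <= limn_einf (F^~ x) by apply: limn_einf_ge; apply: nearW => j; exact: F0.
    move: key; case: (limn_einf _) => [z| |]// key _.
    have := key (Df x - (z + 1) / p x)%R; rewrite -yx expR_gt0 => /(_ isT).
    have -> : (p x * (Df x - (Df x - (z + 1) / p x)) = z + 1)%R.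
      by field; rewrite gt_eqF.
    by rewrite lee_fin gerDl ler10.
  rewrite GE//; apply/lee_addgt0Pr => e e0.
  have := key (ln (l x * v x) + e / p x)%R.
  rewrite expRD lnK// ltr_pMr// expR_gt1 divr_gt0// => /(_ isT) H.
  rewrite -leeBlDr// -EFinB; apply: le_trans H; rewrite lee_fin.
  rewrite [leRHS](_ : _ = p x * (Df x - ln (l x * v x)) - e)%R//.
  by field; rewrite gt_eqF.
have IG : \int[leb R d]_x G x <= ID + a%:E.
  apply: (@le_trans _ _ (\int[leb R d]_x limn_einf (F^~ x))).
    apply: ae_ge0_le_integral => //.
    - by move=> x _; apply: limn_einf_ge; apply: nearW => j; exact: F0.
    - exact: measurable_fun_limn_einf.
    - by apply: filterS GF => x + _.
  apply: le_trans (fatou _ _ _ _) _ => //.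
  exact: limn_einf_le.
have IDfin : ID = (fine ID)%:E by rewrite fineK// ge0_fin_numE.
have iD : (leb R d).-integrable setT (fun x => (p x * Df x)%:E).
  apply/integrableP; split; first by apply/measurable_EFinP; exact: measurable_funM.
  rewrite (eq_integral (fun x => (p x * Df x)%:E))// => x _.
  by rewrite gee0_abs// lee_fin mulr_ge0.
have iG : (leb R d).-integrable setT G.
  apply/integrableP; split => //.
  rewrite (eq_integral G); first by apply: le_lt_trans IG _; rewrite lte_add_pinfty// ltry.
  by move=> x _; rewrite gee0_abs.
have WE : weighted_entropy l = G \- (fun x => (p x * Df x)%:E).
  by apply/funext => x /=; rewrite /G addeAC subee ?add0e.
rewrite WE; split; first exact: integrableB.
rewrite integralB// -/ID.
by rewrite IDfin leeBlDr// addeC -IDfin.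
Qed.

End entropy_limit.

(** * Uniform bounds on likelihood products *)

Section uniform_bound.
Local Open Scope ereal_scope.
Context {R : realType} {d : nat} (p : 'rV[R]_d -> R) (Dp : D R d p).
Variables (v : 'rV[R]_d -> R) (lam0 : R) (M : nat).
Hypotheses (mv : measurable_fun setT v) (v0 : forall x, (0 <= v x)%R)
  (lam00 : (0 < lam0)%R)
  (pv : \int[leb R d]_x (p x * v x `^ lam0)%:E < +oo).
Variables (F : nat -> set ('rV[R]_d -> R)) (a : R).
Hypotheses
  (FP : forall k f, F k f ->
     [/\ logconcave_fun f, measurable_fun setT f & forall x, (f x <= M%:R)%R])
  (Fdec : forall j k, (j <= k)%N -> F k `<=` F j)
  (Flim : forall (f : nat -> 'rV[R]_d -> R) (l : 'rV[R]_d -> R),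
     (forall j, F j (f j)) ->
     (forall x, limn_einf (fun j => (f j x)%:E) = (l x)%:E) ->
     measurable_fun setT l -> (forall x, (0 <= l x <= M%:R)%R) ->
     (leb R d).-integrable setT (weighted_entropy p v l) ->
     \int[leb R d]_x weighted_entropy p v l x <= a%:E -> False).

(** Otherwise, for each [k] some [f k] in [F k] has no good bracket at fineness
    [k] with the power [lam0 / (k + 1)].  Compactness gives a subsequence whose
    brackets are asymptotically below its lower limit [l], and passing to the
    limit in the moments contradicts [Flim].  The classes [F k] decrease with
    [k] so that a property of [f k] can become sharper along the sequence. *)
Lemma finite_bracketing : exists k lam, (0 < lam)%R /\ forall f, F k f ->
  exists b : {ffun {ffun 'I_d * 'I_(grid_size k) -> bool} -> 'I_(k.+1 * M).+1},
    let U := step_bracket (R := R) k [ffun z => b z : nat] in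
    (forall x, (f x <= U x)%R) /\
    \int[leb R d]_x (p x * (U x * v x) `^ lam)%:E < (expR (- lam * a))%:E.
Proof.
apply: contrapT => noB.
pose lam k : R := (lam0 / k.+1%:R)%R.
have lamP k : (0 < lam k <= lam0)%R.
  by rewrite /lam divr_gt0//= ler_pdivrMr// ler_peMr ?ler1n// ltW.
have /choice[f fP] : forall k, exists f, F k f /\
    forall b : {ffun {ffun 'I_d * 'I_(grid_size k) -> bool} -> 'I_(k.+1 * M).+1},
    let U := step_bracket (R := R) k [ffun z => b z : nat] in
    (forall x, (f x <= U x)%R) ->
    (expR (- lam k * a))%:E <= \int[leb R d]_x (p x * (U x * v x) `^ lam k)%:E.
  move=> k; apply: contrapT => nof; apply: noB; exists k, (lam k).
  split=> [|f Ff]; first by case/andP: (lamP k).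
  apply: contrapT => nob; apply: nof; exists f; split => // b U fU.
  by rewrite leNgt; apply/negP => h; apply: nob; exists b.
have lf k : logconcave_fun (f k) by have [/FP[]] := fP k.
have fM k x : (0 <= f k x <= M%:R)%R.
  by have [/FP[[-> _] _ ->]] := fP k.
have /choice[U UP] : forall k, exists U : 'rV[R]_d -> R,
    [/\ measurable_fun setT U, (forall x, (0 <= U x <= M%:R)%R),
     (forall x, exists2 y, cell k x = cell k y & (U x <= f k y + k.+1%:R^-1)%R) &
     (expR (- lam k * a))%:E <= \int[leb R d]_x (p x * (U x * v x) `^ lam k)%:E].
  move=> k; have [b /= [fU UM Uy]] := step_bracket_exists k M (f k) (fM k).
  exists (step_bracket k [ffun z => b z : nat]); split => //.
    exact: measurable_step_bracket.
  by have [_ /(_ b fU)] := fP k.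
have near_bound (x : 'rV[R]_d) : exists N : nat, forall k, (N <= k)%N -> near_point 0 k%:R x.
  have [N _ HN] : \forall k \near \oo, forall i : 'I_d,
      (`|x ord0 i - (0 : 'rV[R]_d) ord0 i| < k%:R)%R.
    apply: filter_forall => i; rewrite mxE subr0.
    exists (Num.truncn `|x ord0 i|).+1 => // k /= Nk.
    by apply: lt_le_trans (truncnS_gt _) _; rewrite ler_nat.
  by exists N => k Nk; exact: HN.
have Unear (x : 'rV[R]_d) (e : R) : (0 < e)%R ->
    \forall j \near \oo, exists2 y, near_point x e y & (U j x <= f j y + e)%R.
  move=> e0; have [N HN] := near_bound x.
  have [n [h nh /andP[h0 he]]] := small_inv e e0.
  exists (maxn N n) => // j /=; rewrite geq_max => /andP[Nj nj].
  have [_ _ /(_ x)[y xy Uy] _] := UP j.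
  have je : (j.+1%:R^-1 <= e)%R.
    apply: le_trans (ltW he); rewrite -nh lef_pV2 ?posrE// ler_nat; exact: nj.
  exists y; first by apply: near_point_le je _ _; apply: near_cell xy; exact: HN.
  by apply: le_trans Uy _; rewrite lerD2l.
have [phi phiS Hphi] := logconcave_compactness f U lf Unear.
have phi_ge j : (j <= phi j)%N.
  by elim: j => // j IH; apply: leq_ltn_trans IH _; exact: phiS.
pose l x := fine (limn_einf (fun j => (f (phi j) x)%:E)).
have lfin x : limn_einf (fun j => (f (phi j) x)%:E) = (l x)%:E /\ (0 <= l x <= M%:R)%R.
  have h0 : 0 <= limn_einf (fun j => (f (phi j) x)%:E).
    by apply: limn_einf_ge; apply: nearW => j; rewrite lee_fin; case/andP: (fM (phi j) x).
  have h1 : limn_einf (fun j => (f (phi j) x)%:E) <= M%:R%:E.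
    by apply: limn_einf_le => j; rewrite lee_fin; case/andP: (fM (phi j) x).
  have hf : limn_einf (fun j => (f (phi j) x)%:E) = (l x)%:E.
    by rewrite fineK// ge0_fin_numE// (le_lt_trans h1)// ltry.
  by split => //; rewrite -!lee_fin -hf h0.
have ml : measurable_fun setT l.
  apply/measurable_EFinP.
  rewrite (_ : _ \o _ = fun x => limn_einf (fun j => (f (phi j) x)%:E)).
    apply: measurable_fun_limn_einf => j; apply/measurable_EFinP.
    by have [/FP[]] := fP (phi j).
  by apply/funext => x /=; have [->] := lfin x.
have [iW W] : (leb R d).-integrable setT (weighted_entropy p v l) /\
    \int[leb R d]_x weighted_entropy p v l x <= a%:E.
  apply: (@weighted_entropy_limit _ _ _ Dp v lam0 M mv v0 lam00 pv
     (U \o phi) (lam \o phi) l a).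
  - by move=> j; have [] := UP (phi j).
  - by move=> j x; have [_ /(_ x)] := UP (phi j).
  - by move=> j; exact: lamP.
  - have phioo : phi @ \oo --> \oo.
      by move=> A [N _ NA]; exists N => // j Nj; apply: NA; exact: leq_trans (phi_ge j).
    have : lam k @[k --> \oo] --> (lam0 * 0)%R by apply: cvgMr; exact: cvg_harmonic.
    by rewrite mulr0; exact: cvg_comp.
  - exact: ml.
  - by move=> x; have [] := lfin x.
  - apply: filterS Hphi => x Hx s ls.
    apply: contrapT => nU; have [lE _] := lfin x.
    have : \forall j \near \oo, ((l x + s) / 2 < f (phi j) x)%R.
      apply: (Hx s); first lra.
      move=> N; apply: contrapT => nN; apply: nU; exists N => // j /= Nj.
      by rewrite leNgt; apply/negP => sU; apply: nN; exists j.
    move=> Hf; suff : ((l x + s) / 2 <= l x)%R by lra.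
    rewrite -lee_fin -lE; apply: limn_einf_ge; apply: filterS Hf => j.
    by rewrite lee_fin => /ltW.
  - by move=> j; have [] := UP (phi j).
apply: (Flim (f \o phi) l) => //.
- by move=> j; apply: (Fdec _ _ (phi_ge j)); have [] := fP (phi j).
- by move=> x; have [] := lfin x.
- by move=> x; have [] := lfin x.
Qed.

(** Every [f] in [F k] lies below one of finitely many step functions, for which
    the bound for a single function applies. *)
Theorem uniform_likelihood_bound : exists k, forall P : probability (sample_path R d) R,
  iid_law p P -> forall d0 : nat,
  {ae P, forall x : sample_path R d, \forall t \near \oo, forall f, F k f ->
    (\prod_(d0 <= s < t) (f (x s) * v (x s)) <= expR (- a * (t%:R - d0%:R)))%R}.
Proof.
have [k [lam [lam_gt0 HB]]] := finite_bracketing.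
exists k => P iidP d0.
pose U (b : {ffun {ffun 'I_d * 'I_(grid_size k) -> bool} -> 'I_(k.+1 * M).+1}) :=
  step_bracket (R := R) k [ffun z => b z : nat].
have U0 b x : (0 <= U b x)%R by rewrite divr_ge0.
pose good b := \int[leb R d]_x (p x * (U b x * v x) `^ lam)%:E < (expR (- lam * a))%:E.
have : {ae P, forall x : sample_path R d, forall b, good b -> \forall t \near \oo,
    (\prod_(d0 <= s < t) (U b (x s) * v (x s)) <= expR (- a * (t%:R - d0%:R)))%R}.
  apply: filter_forall => b; have [gb|ngb] := pselect (good b); last first.
    by apply: aeW => x.
  have mg : measurable_fun setT (fun y => U b y * v y)%R.
    by apply: measurable_funM => //; exact: measurable_step_bracket.
  have g0 y : (0 <= U b y * v y)%R by rewrite mulr_ge0.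
  by apply: filterS (@iid_chernoff _ _ p Dp P iidP _ lam a d0 mg g0 lam_gt0 gb) => x.
apply: filterS => x Hx.
have : \forall t \near \oo, forall b, good b ->
    (\prod_(d0 <= s < t) (U b (x s) * v (x s)) <= expR (- a * (t%:R - d0%:R)))%R.
  apply: filter_forall => b; have [gb|ngb] := pselect (good b).
    by apply: filterS (Hx b gb) => t.
  by apply: nearW => t.
apply: filterS => t Ht f Ff; have [b /= [fU gb]] := HB f Ff.
apply: le_trans (Ht b gb); apply: ler_prod => s _.
have [[f0 _] _ _] := FP k f Ff.
by rewrite mulr_ge0//= ler_wpM2r// fU.
Qed.

End uniform_bound.

(** * Product functions, Gaussian density, negative moments *)

Section product_functions.
Local Open Scope ereal_scope.
Context {R : realType}.

Lemma measurable_prod_coords d (k : R -> R) : measurable_fun setT k ->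
  measurable_fun setT (fun x : 'rV[R]_d => \prod_i k (x ord0 i))%R.
Proof.
move=> mk; apply: measurable_prod => i _.
exact: (measurableT_comp mk (measurable_mx_entry ord0 i)).
Qed.

(** Fubini's theorem, in the form that suits the recursive definition of the
    Lebesgue measure. *)
Lemma integral_leb_prod d (k : R -> R) (c : R) :
  measurable_fun setT k -> (forall u, (0 <= k u)%R) ->
  \int[@lebesgue_measure R]_u (k u)%:E = c%:E ->
  \int[leb R d]_x (\prod_i k (x ord0 i))%:E = (c ^+ d)%:E.
Proof.
move=> mk k0 kc; elim: d => [|d IH].
  rewrite expr0 (eq_integral (cst 1))//; last by move=> x _; rewrite big_ord0.
  by rewrite integral_cst// mul1e /= diracT.
transitivity (\int[pushforward (@lebesgue_measure R \x leb R d) (@cons_rV R d)]_x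
    (\prod_i k (x ord0 i))%:E); first by [].
rewrite ge0_integral_pushforward//=; last 3 first.
- exact: measurable_cons_rV.
- by apply/measurable_EFinP; exact: measurable_prod_coords.
- by move=> x _; rewrite lee_fin prodr_ge0.
rewrite preimage_setT.
rewrite (eq_integral (fun z : measurableTypeR R * 'rV[R]_d =>
  (k z.1)%:E * (\prod_i k (z.2 ord0 i))%:E)); last first.
  move=> z _; rewrite big_ord_recl cons_rV0 EFinM; congr (_ * _%:E).
  by apply: eq_bigr => i _; rewrite cons_rVS.
have mkE : measurable_fun setT (fun u : measurableTypeR R => (k u)%:E).
  by apply/measurable_EFinP.
rewrite fubini_tonelli1//=; first last.
- by move=> z; rewrite mule_ge0// lee_fin// prodr_ge0.
- apply: emeasurable_funM; first exact: (measurableT_comp mkE measurable_fst).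
  apply/measurable_EFinP.
  exact: (measurableT_comp (@measurable_prod_coords d k mk) measurable_snd).
rewrite /fubini_F/= (eq_integral (fun u : measurableTypeR R => (c ^+ d)%:E * (k u)%:E)).
  rewrite ge0_integralZl//.
  - by rewrite kc -EFinM -exprSr.
  - by move=> u _; rewrite lee_fin.
  - rewrite -IH; apply: integral_ge0 => x _; rewrite lee_fin; exact: prodr_ge0.
move=> u _; rewrite ge0_integralZl//.
- by rewrite IH muleC.
- by apply/measurable_EFinP; exact: measurable_prod_coords.
- by move=> x _; rewrite lee_fin prodr_ge0.
- by rewrite lee_fin.
Qed.

End product_functions.

Section gaussian.
Local Open Scope ereal_scope.
Context {R : realType} {d : nat}.

Lemma gaussian_density_gt0 (x : 'rV[R]_d) : (0 < gaussian_density x)%R.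
Proof.
apply: prodr_gt0 => i _; rewrite normal_pdfE ?oner_neq0//.
by rewrite mulr_gt0 ?normal_peak_gt0 ?oner_neq0// expR_gt0.
Qed.

Lemma gaussian_density_D : D R d (@gaussian_density R d).
Proof.
split.
- exact: (measurable_prod_coords _ _ (measurable_normal_pdf 0 1)).
- by move=> x; exact/ltW/gaussian_density_gt0.
- rewrite (integral_leb_prod _ _ 1) ?expr1n//.
  + exact: measurable_normal_pdf.
  + by move=> u; exact: normal_pdf_ge0.
  + exact: integral_normal_pdf.
Qed.

Lemma logconcave_gaussian_density : logconcave_fun (@gaussian_density R d).
Proof.
split=> [x|x y t /andP[t0 t1]]; first exact/ltW/gaussian_density_gt0.
have NE u : normal_pdf 0 1 u = expR (ln (normal_peak 1) - u ^+ 2 / 2)%R :> R.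
  rewrite normal_pdfE ?oner_neq0// expRD lnK ?posrE ?normal_peak_gt0 ?oner_neq0//.
  by congr (_ * expR _)%R; rewrite subr0 expr1n -mulr_natr mul1r mulNr.
have N0 (u : R) : (0 <= normal_pdf 0 1 u)%R by exact: normal_pdf_ge0.
rewrite !powR_prod// -big_split/=; apply: ler_prod => i _.
rewrite mulr_ge0 ?powR_ge0//= !NE /powR !gt_eqF ?expR_gt0// !expRK -expRD ler_expR.
rewrite !mxE; set u := x _ _; set w := y _ _.
have := mulr_ge0 (mulr_ge0 (ltW t0) (ltW (eqbRL (subr_gt0 _ _) t1))) (sqr_ge0 (u - w)%R).
lra.
Qed.

End gaussian.

Section negative_moment.
Local Open Scope ereal_scope.
Context {R : realType} {d : nat} (p : 'rV[R]_d -> R) (D1p : D1 R d p).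

Lemma integral_oneDsqrV :
  \int[@lebesgue_measure R]_u ((oneDsqr u)^-1)%:E = (pi : R)%:E.
Proof.
rewrite ge0_symfun_integralT.
- rewrite -set_itvcy integral0y_oneDsqr -EFinM; congr EFin.
  by rewrite mulrCA divff ?mulr1.
- by move=> u; rewrite invr_ge0 (le_trans ler01)// oneDsqr_ge1.
- exact: continuous_oneDsqrV.
- by move=> u; rewrite /= /oneDsqr sqrrN.
Qed.

Lemma abs_coord_le_norm (x : 'rV[R]_d) i : (`|x ord0 i| <= euclidean_norm x)%R.
Proof.
rewrite -sqrtr_sqr ler_wsqrtr// (bigD1 i)//= lerDl.
by apply: sumr_ge0 => j _; exact: sqr_ge0.
Qed.

(** If the power [q] of [1 / p] is at most [1 + euclidean_norm x], the first term
    suffices.  Otherwise [q] exceeds [1 + `|x i|] for each coordinate; since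
    [p = q ^- (2 * d).+1] by the choice of [lam], the left-hand side is
    [q ^- (2 * d)], which allows two factors of [q] for each coordinate. *)
Lemma negative_moment_pointwise (x : 'rV[R]_d) (lam := ((2 * d).+1%:R^-1)%R : R) :
  (0 <= p x)%R -> (p x * (p x)^-1 `^ lam <=
    p x * (1 + euclidean_norm x) + \prod_i (oneDsqr (x ord0 i))^-1)%R.
Proof.
move=> p0; set e := euclidean_norm x; set Pi := (\prod_i _)%R.
have e0 : (0 <= e)%R by exact: sqrtr_ge0.
have Pi0 : (0 <= Pi)%R.
  by apply: prodr_ge0 => i _; rewrite invr_ge0 (le_trans ler01)// oneDsqr_ge1.
have [px0|px0] := eqVneq (p x) 0%R; first by rewrite px0 !mul0r add0r.
have px : (0 < p x)%R by rewrite lt_neqAle eq_sym px0.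
set q := (_ `^ lam)%R.
have q0 : (0 < q)%R by rewrite powR_gt0// invr_gt0.
have qE : (q ^+ (2 * d).+1 = (p x)^-1)%R.
  rewrite -powR_mulrn ?ltW// -powRrM mulVf ?powRr1 ?invr_ge0//.
have [qe|eq] := leP q (1 + e)%R.
  by apply: ler_wpDr => //; rewrite ler_wpM2l.
apply: ler_wpDl; first by rewrite mulr_ge0// addr_ge0.
have -> : (p x * q = (q ^+ (2 * d))^-1)%R.
  have qn : (q ^+ (2 * d) != 0)%R by rewrite expf_neq0// gt_eqF.
  by apply: (mulIf qn); rewrite mulVf// -mulrA -exprS qE divff.
have D0 i : (0 < oneDsqr (x ord0 i))%R.
  by rewrite (lt_le_trans ltr01)// oneDsqr_ge1.
rewrite /Pi prodfV lef_pV2 ?posrE ?exprn_gt0 ?prodr_gt0//.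
rewrite exprM -[X in (_ ^+ X)%R](card_ord d) -prodr_const.
apply: ler_prod => i _; rewrite (ltW (D0 i))//=.
apply: (@le_trans _ _ ((1 + `|x ord0 i|) ^+ 2)%R).
  by rewrite /oneDsqr sqrrD expr1n mul1r real_normK ?num_real// lerD2r lerDl mulrn_wge0.
rewrite lerXn2r ?nnegrE ?addr_ge0 ?(ltW q0)//.
by apply: le_trans (ltW eq); rewrite lerD2l abs_coord_le_norm.
Qed.

Lemma negative_moment :
  exists2 lam : R, (0 < lam)%R & \int[leb R d]_x (p x * (p x)^-1 `^ lam)%:E < +oo.
Proof.
have [[mp p0 p1] _ pe] := D1p.
exists ((2 * d).+1%:R^-1)%R => //.
have mpi : measurable_fun setT (fun u : R => (oneDsqr u)^-1)%R.
  apply: continuous_measurable_fun; exact: continuous_oneDsqrV.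
have pi0 (u : R) : (0 <= (oneDsqr u)^-1)%R.
  by rewrite invr_ge0 (le_trans ler01)// oneDsqr_ge1.
have me : measurable_fun setT (@euclidean_norm R d).
  have msum : measurable_fun setT (fun x : 'rV[R]_d => \sum_(i < d) x ord0 i ^+ 2)%R.
    by apply: measurable_sum => i; apply: measurable_funX; exact: measurable_mx_entry.
  apply: (measurableT_comp _ msum); apply: continuous_measurable_fun.
  exact: sqrt_continuous.
have mPi : measurable_fun setT (fun x : 'rV[R]_d => \prod_i (oneDsqr (x ord0 i))^-1)%R.
  exact: (measurable_prod_coords d _ mpi).
have e0 (x : 'rV[R]_d) : (0 <= euclidean_norm x)%R by exact: sqrtr_ge0.
have mv : measurable_fun setT (fun x => (p x)^-1)%R by exact: measurable_inv_ge0.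
apply: (@le_lt_trans _ _ (\int[leb R d]_x ((p x)%:E +
    ((p x)%:E * (euclidean_norm x)%:E + (\prod_i (oneDsqr (x ord0 i))^-1)%:E)))).
  apply: ge0_le_integral => //.
  - by move=> x _; rewrite lee_fin mulr_ge0// powR_ge0.
  - apply/measurable_EFinP; apply: measurable_funM => //.
    exact: (measurableT_comp (measurable_powR _) mv).
  - apply/emeasurable_funD; first exact/measurable_EFinP.
    apply: emeasurable_funD; last exact/measurable_EFinP.
    by apply: emeasurable_funM; exact/measurable_EFinP.
  - move=> x _; rewrite -EFinM -!EFinD lee_fin.
    by have := negative_moment_pointwise x (p0 x); rewrite mulrDr mulr1 addrA.
rewrite ge0_integralD//; first last.
- apply: emeasurable_funD; last exact/measurable_EFinP.
  by apply: emeasurable_funM; exact/measurable_EFinP.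
- by move=> x _; rewrite adde_ge0 ?mule_ge0 ?lee_fin// prodr_ge0.
- exact/measurable_EFinP.
- by move=> x _; rewrite lee_fin.
rewrite p1 lte_add_pinfty// ?ltry// ge0_integralD//; first last.
- exact/measurable_EFinP.
- by move=> x _; rewrite lee_fin prodr_ge0.
- by apply: emeasurable_funM; exact/measurable_EFinP.
- by move=> x _; rewrite mule_ge0 ?lee_fin.
apply: lte_add_pinfty; first exact: pe.
have -> := integral_leb_prod d (fun u => (oneDsqr u)^-1)%R pi mpi pi0 integral_oneDsqrV.
exact: ltry.
Qed.

End negative_moment.

(** * Bounded log-concave subdensities *)

Section likelihood_bound.
Local Open Scope ereal_scope.
Context {R : realType} {d : nat}.

Definition subdensity (f : 'rV[R]_d -> R) :=
  [/\ logconcave_fun f, measurable_fun setT f & \int[leb R d]_x (f x)%:E <= 1].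

Lemma subdensity_limn_einf (f : nat -> 'rV[R]_d -> R) (l : 'rV[R]_d -> R) :
  (forall j, subdensity (f j)) -> measurable_fun setT l ->
  (forall x, limn_einf (fun j => (f j x)%:E) = (l x)%:E) -> subdensity l.
Proof.
move=> sf ml lE; split => //.
  by apply: logconcave_limn_einf lE => j; have [] := sf j.
rewrite (eq_integral (fun x => limn_einf (fun j => (f j x)%:E))); last first.
  by move=> x _; rewrite lE.
apply: (@le_trans _ _ (limn_einf (fun j => \int[leb R d]_x (f j x)%:E))).
  apply: (@fatou _ _ _ (leb R d) setT measurableT (fun j x => (f j x)%:E)).
  - by move=> j; apply/measurable_EFinP; have [] := sf j.
  - by move=> j x _; rewrite lee_fin; have [[->]] := sf j.
by apply: limn_einf_le => j; have [] := sf j.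
Qed.

Variables (p : 'rV[R]_d -> R) (Dp : D R d p).

Lemma weighted_entropyE (l : 'rV[R]_d -> R) (c : R) x :
  (0 <= p x)%R -> (0 <= l x)%R -> (0 < c)%R ->
  (p x)%:E * (lne (p x)%:E - lne (c * l x)%:E) =
  weighted_entropy p (fun y => (p y)^-1)%R l x - (p x * ln c)%:E.
Proof.
move=> + + c0; rewrite /weighted_entropy.
rewrite le_eqVlt => /orP[/eqP <- _|px]; first by rewrite !mul0e mul0r sub0e oppe0.
rewrite le_eqVlt => /orP[/eqP <-|lx].
  by rewrite mulr0 mul0r lne0 lne_EFin//= gt0_muley ?lte_fin.
have ipx : (0 < (p x)^-1)%R by rewrite invr_gt0.
rewrite !lne_EFin ?mulr_gt0// !lnM ?posrE// lnV ?posrE//.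
by rewrite -!EFinD -!EFinM; congr EFin; ring.
Qed.

Lemma integrable_density : (leb R d).-integrable setT (fun x => (p x)%:E).
Proof.
have [mp p0 p1] := Dp; apply/integrableP; split; first exact/measurable_EFinP.
rewrite (eq_integral (fun x => (p x)%:E)) ?p1 ?ltry// => x _.
by rewrite gee0_abs// lee_fin.
Qed.

(** The integral of [l] is positive, since otherwise the entropy would be
    infinite, and at most one, so normalising multiplies [l] by a factor of at
    least one, which can only decrease the divergence. *)
Lemma KL_normalized_subdensity (l : 'rV[R]_d -> R) (a : R) : subdensity l ->
  (leb R d).-integrable setT (weighted_entropy p (fun y => (p y)^-1)%R l) ->
  \int[leb R d]_x weighted_entropy p (fun y => (p y)^-1)%R l x <= a%:E ->
  exists2 l', L R d l' & KL p l' <= a%:E.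
Proof.
move=> [cl ml l1] iW Wa; have [mp p0 p1] := Dp; have [l0 _] := cl.
pose I := \int[leb R d]_x (l x)%:E.
have I0 : 0 <= I by apply: integral_ge0 => x _; rewrite lee_fin.
have IE : I = (fine I)%:E by rewrite fineK// ge0_fin_numE// (le_lt_trans l1)// ltry.
have Ipos : (0 < fine I)%R.
  rewrite -lte_fin -IE lt_neqAle I0 andbT; apply/eqP => Iz.
  have lz : {ae leb R d, forall x, l x = 0%R}.
    have : \int[leb R d]_x `|(l x)%:E| = 0.
      by rewrite (eq_integral (fun x => (l x)%:E))// => x _; rewrite gee0_abs ?lee_fin.
    move/ae_eq_integral_abs => /(_ measurableT) H.
    have /H : measurable_fun setT (fun x => (l x)%:E) by exact/measurable_EFinP.
    by apply: filterS => x /(_ Logic.I)[].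
  have : {ae leb R d, forall x, weighted_entropy p (fun y => (p y)^-1)%R l x \is a fin_num}.
    by apply: filterS (integrable_ae measurableT iW) => x; exact.
  move=> Wfin; have : \int[leb R d]_x (p x)%:E = 0.
    rewrite (ae_eq_integral (cst 0)) ?integral0//; first exact/measurable_EFinP.
    apply: filterS2 lz Wfin => x lx Wx _ /=; congr EFin; apply/eqP.
    apply: contraTT Wx => px.
    have px' : (0 < p x)%R by rewrite lt_neqAle eq_sym px p0.
    by rewrite /weighted_entropy lx mul0r lne0 gt0_muley ?lte_fin.
  by rewrite p1 => /eqP; rewrite onee_eq0.
pose c := ((fine I)^-1)%R.
have c0 : (0 < c)%R by rewrite invr_gt0.
have c1 : (0 <= ln c)%R by rewrite ln_ge0// invf_ge1// -lee_fin -IE.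
pose l' x := (c * l x)%R.
have ml' : measurable_fun setT l' by exact: measurable_funM.
have D' : D R d l'.
  split=> //; first by move=> x; rewrite mulr_ge0// ltW.
  rewrite /l'; under eq_integral do rewrite EFinM.
  rewrite ge0_integralZl//.
  - by rewrite -/I IE -EFinM mulVf// gt_eqF.
  - exact/measurable_EFinP.
  - by move=> x _; rewrite lee_fin.
  - by rewrite lee_fin ltW.
exists l'.
  split => //; exists l'; split; last exact: aeW.
  by split => //; apply/logconcave_funP; apply: logconcave_scale => //; exact: ltW.
rewrite /KL (eq_integral (fun x => weighted_entropy p (fun y => (p y)^-1)%R l x -
  (p x * ln c)%:E)); last by move=> x _; rewrite -weighted_entropyE.
have ip : (leb R d).-integrable setT (fun x => (p x * ln c)%:E).
  under eq_fun do rewrite mulrC EFinM.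
  by apply: integrableZl => //; exact: integrable_density.
rewrite integralB//; apply: le_trans Wa.
rewrite -[leRHS]sube0 leeB// integral_ge0// => x _.
by rewrite lee_fin mulr_ge0.
Qed.

(** The lower limit of a sequence of subdensities is a subdensity, so its
    normalisation is a member of [L]; its divergence cannot be at most [a]. *)
Lemma bounded_subdensity_bound (M : nat) (lam a : R) :
  (0 < lam)%R -> \int[leb R d]_x (p x * (p x)^-1 `^ lam)%:E < +oo ->
  (forall l, L R d l -> a%:E < KL p l) ->
  forall P : probability (sample_path R d) R, iid_law p P -> forall d0 : nat,
  {ae P, forall x : sample_path R d, \forall t \near \oo, forall f, subdensity f ->
    (forall y, (f y <= M%:R)%R) ->
    (\prod_(d0 <= s < t) (f (x s) * (p (x s))^-1) <= expR (- a * (t%:R - d0%:R)))%R}.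
Proof.
move=> lam0 plam aKL.
have [mp p0 p1] := Dp.
have mv : measurable_fun setT (fun x => (p x)^-1)%R by exact: measurable_inv_ge0.
have v0 x : (0 <= (p x)^-1)%R by rewrite invr_ge0.
have [|||k Hk] := @uniform_likelihood_bound R d p Dp _ lam M mv v0 lam0 plam
   (fun=> [set f | subdensity f /\ forall y, (f y <= M%:R)%R]) a.
- by move=> k f [[]].
- by move=> j k _ f.
- move=> f l fF lE ml lM iW Wa.
  have sl := subdensity_limn_einf f l (fun j => (fF j).1) ml lE.
  have [l' Ll'] := KL_normalized_subdensity l a sl iW Wa.
  by rewrite leNgt aKL.
move=> P iidP d0; apply: filterS (Hk P iidP d0) => x; apply: filterS => t Ht f sf fM.
exact: Ht.
Qed.

End likelihood_bound.

(** * Tall log-concave subdensities *)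

Section tall.
Local Open Scope ereal_scope.
Context {R : realType} {d : nat}.

Lemma leb_near_point (c : 'rV[R]_d) (r : R) : (0 < r)%R ->
  leb R d (near_point c r) = ((r * 2) ^+ d)%:E.
Proof.
move=> r0; rewrite (_ : near_point c r =
    [set x | forall i, `](c ord0 i - r)%R, (c ord0 i + r)%R[%classic (x ord0 i)]).
  transitivity (\prod_(i < d)
      @lebesgue_measure R `](c ord0 i - r)%R, (c ord0 i + r)%R[%classic).
    by rewrite -leb_box.
  under eq_bigr do rewrite lebesgue_measure_itv/= lte_fin -EFinB.
  rewrite (eq_bigr (fun=> (r * 2)%:E)).
    by rewrite prodEFin prodr_const card_ord.
  by move=> i _; rewrite ifT; [congr EFin; ring|lra].
have E (a b : R) : (`|a - b| < r = (b - r < a < b + r))%R.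
  by rewrite ltr_norml; apply/andP/andP => -[]; split; lra.
by apply/seteqP; split => y H i; have := H i; rewrite /= in_itv/= E.
Qed.

Lemma lower_bound_near_point (f : 'rV[R]_d -> R) (c : 'rV[R]_d) (r k : R) :
  subdensity f -> (0 < r)%R -> (forall y, near_point c r y -> (k <= f y)%R) ->
  (k * (r * 2) ^+ d <= 1)%R.
Proof.
move=> [[f0 _] mf f1] r0 kf.
have [k0|k0] := leP k 0%R.
  by apply: (@le_trans _ _ 0%R) => //; rewrite mulr_le0_ge0// exprn_ge0 ?mulr_ge0// ltW.
rewrite -lee_fin EFinM -(leb_near_point c)//; apply: le_trans f1.
have mN := measurable_near_point c r.
rewrite -[X in _ * leb R d X]setIT -integral_indic// -ge0_integralZl//; last 2 first.
- by apply/measurable_EFinP; exact: measurable_indic.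
- by rewrite lee_fin ltW.
apply: ge0_le_integral => //.
- by move=> x _; rewrite mule_ge0 ?lee_fin// ltW.
- by apply: emeasurable_funM => //; apply/measurable_EFinP; exact: measurable_indic.
- exact/measurable_EFinP.
move=> x _; rewrite -EFinM lee_fin indicE; have [xN|xN] := pselect (near_point c r x).
  by rewrite mem_set// mulr1 kf.
by rewrite memNset// mulr0.
Qed.

(** Taking the root of order [m] makes the class bounded, so that the compactness
    argument applies, and a bound by a constant less than one on the roots
    becomes a bound on [f] that improves with the height of its peak. *)
Definition tall_root (k : nat) : set ('rV[R]_d -> R) :=
  [set g | exists f m y, [/\ subdensity f, (k.+1%:R <= m)%R, f y = expR m,
     forall x, (f x <= expR m)%R & g = (fun x => f x `^ m^-1)%R]].

Lemma tall_rootP k g : tall_root k g ->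
  [/\ logconcave_fun g, measurable_fun setT g, forall x, (g x <= expR 1)%R
    & exists y, g y = expR 1].
Proof.
move=> [f [m [y [[cf mf f1] km fy fm gE]]]]; have [f0 _] := cf.
have m0 : (0 < m)%R by exact: lt_le_trans km.
have e1 : (expR m `^ m^-1 = expR 1 :> R)%R.
  by rewrite /powR gt_eqF ?expR_gt0// expRK mulVf// gt_eqF.
rewrite gE; split.
- by apply: logconcave_powR => //; rewrite invr_ge0 ltW.
- exact: (measurableT_comp (measurable_powR _) mf).
- move=> x; rewrite -e1; apply: ge0_ler_powR; rewrite ?nnegrE ?expR_ge0//.
  by rewrite invr_ge0 ltW.
- by exists y; rewrite fy e1.
Qed.

(** Otherwise the convex set where [l] exceeds [expR (- 1/2)] is not null,
    so it has an interior point and contains the corners of a cube around it,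
    and for large [j] so does the superlevel set of [g j] at the same height. At
    the midpoints between this cube and the point where [g j] attains its
    maximum [expR 1], log-concavity gives [g j >= expR (1/4)], hence
    [f >= expR (m / 4)], on a cube of fixed volume; as [m] tends to infinity this
    contradicts that the integral of [f] is at most one. *)
Lemma tall_root_limit (g : nat -> 'rV[R]_d -> R) (l : 'rV[R]_d -> R) :
  (forall j, tall_root j (g j)) -> measurable_fun setT l ->
  (forall x, limn_einf (fun j => (g j x)%:E) = (l x)%:E) ->
  {ae leb R d, forall x, (l x <= expR (- 2^-1))%R}.
Proof.
move=> gT ml lE.
have cg j : logconcave_fun (g j) by have [] := tall_rootP _ _ (gT j).
have cl := logconcave_limn_einf _ _ cg lE.
pose K := [set x | expR (- 2^-1) < l x]%R.
have cK : segment_closed K by apply: logconcave_superlevel => //; exact: expR_ge0.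
have mK : measurable K.
  rewrite (_ : K = l @^-1` `]expR (- 2^-1), +oo[%classic); last first.
    by apply/seteqP; split => x; rewrite /K /= in_itv/= andbT.
  by rewrite -[X in measurable X]setTI; exact: ml.
suff K0 : rat_interior K = set0.
  exists K; split => //; first by have := convex_boundary_null _ _ mK cK; rewrite K0 setD0.
  by move=> x /=/negP; rewrite -ltNge.
apply/seteqP; split=> // x /rat_interior_corners[r r0 rK].
have gK : \forall j \near \oo, forall s, (expR (- 2^-1) < g j (corner x r s))%R.
  apply: filter_forall => s.
  have : ((expR (- 2^-1))%:E < limn_einf (fun j => (g j (corner x r s))%:E)).
    by rewrite lE lte_fin; exact: rK.
  by move/limn_einf_gt; apply: filterS => j; rewrite lte_fin.
have [N _ HN] := gK.
have V0 : (0 < (r / 2 * 2) ^+ d)%R by rewrite exprn_gt0// divfK.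
pose j := maxn N (Num.truncn (4 / (r / 2 * 2) ^+ d)).+1.
have [f [m [y [sf jm fy fm gE]]]] := gT j.
have m0 : (0 < m)%R by exact: lt_le_trans jm.
pose mid := (2^-1 *: x + 2^-1 *: y)%R.
have : (expR (m / 4) * (r / 2 * 2) ^+ d <= 1)%R.
  apply: (lower_bound_near_point f mid) => // [|z zmid]; first by rewrite divr_gt0.
  (* z is the midpoint of the maximum point y and of a point w of the cube. *)
  pose w := (2 *: z - y)%R.
  have zE : z = (2^-1 *: w + (1 - 2^-1) *: y)%R.
    by apply/rowP => i; rewrite !mxE; lra.
  have wg : (expR (- 2^-1) < g j w)%R.
    apply: (orthants_meet_convex [set z | expR (- 2^-1) < g j z]%R).
      by apply: logconcave_superlevel => //; exact: expR_ge0.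
    move=> s; exists (corner x r (finfun s)); first by apply: HN => /=; exact: leq_maxl.
    move=> i; rewrite cornerE ffunE !mxE; have := zmid i.
    by rewrite !mxE ltr_norml => /andP[h1 h2]; case: (s i); lra.
  have gz : (expR (4^-1) <= g j z)%R.
    have [_ /(_ w y (2^-1)%R)] := cg j.
    rewrite -zE invr_gt0 ltr0n invf_lt1// ltr1n => /(_ isT).
    have -> : g j y = expR 1.
      by rewrite gE fy /powR gt_eqF ?expR_gt0// expRK mulVf// gt_eqF.
    apply: le_trans.
    have e4 : (expR 4^-1 = expR (- 2^-1) `^ 2^-1 * expR 1 `^ (1 - 2^-1) :> R)%R.
      rewrite /powR !gt_eqF ?expR_gt0// !expRK -expRD; congr expR; lra.
    rewrite e4 ler_wpM2r ?powR_ge0//.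
    apply: ge0_ler_powR; rewrite ?nnegrE ?expR_ge0 ?invr_ge0//.
      by have [] := cg j.
    exact: ltW.
  have fE : (f z = g j z `^ m)%R.
    by rewrite gE -powRrM mulVf ?gt_eqF// powRr1//; have [[]] := sf.
  rewrite fE (_ : expR (m / 4) = expR 4^-1 `^ m)%R; last first.
    by rewrite /powR gt_eqF ?expR_gt0// expRK.
  by apply: ge0_ler_powR; rewrite ?nnegrE ?expR_ge0 ?(ltW m0)//; have [] := cg j.
apply/negP; rewrite -ltNge.
have jV : (4 / (r / 2 * 2) ^+ d < m)%R.
  apply: lt_le_trans (truncnS_gt _) _; apply: le_trans jm; rewrite ler_nat.
  by apply: leqW; exact: leq_maxr.
have : (m / 4 < expR (m / 4))%R.
  by apply: lt_le_trans (expR_ge1Dx _); rewrite ltrDr.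
move: jV; rewrite ltr_pdivrMr// => jV mE.
have : (m / 4 * (r / 2 * 2) ^+ d < expR (m / 4) * (r / 2 * 2) ^+ d)%R by rewrite ltr_pM2r.
by apply: lt_trans; rewrite mulrAC ltr_pdivlMr// mul1r.
Qed.

Variables (p : 'rV[R]_d -> R) (Dp : D R d p).

(** In the limit the roots are at most [expR (- 1/2)], so the cross entropy is at
    least [1/2]; any rate below that, such as [1/4], is admissible. *)
Lemma tall_root_bound : exists k, forall P : probability (sample_path R d) R,
  iid_law p P -> forall d0 : nat,
  {ae P, forall x : sample_path R d, \forall t \near \oo, forall g, tall_root k g ->
    (\prod_(d0 <= s < t) g (x s) <= expR (- 4^-1 * (t%:R - d0%:R)))%R}.
Proof.
have [mp p0 p1] := Dp.
pose M := (Num.truncn (expR 1 : R)).+1.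
have eM : (expR 1 <= M%:R :> R)%R by apply/ltW/truncnS_gt.
have int1 : \int[leb R d]_x (p x * 1 `^ 1)%:E < +oo.
  by under eq_integral do rewrite powR1 mulr1; rewrite p1 ltry.
have m1 : measurable_fun setT (fun _ : 'rV[R]_d => 1%R : R) by exact: measurable_cst.
have [|||k Hk] := @uniform_likelihood_bound R d p Dp (fun=> 1%R) 1%R M
   m1 (fun=> ler01) ltr01 int1 tall_root 4^-1%R.
- move=> k g /tall_rootP[cg mg ge _]; split => // x; exact: le_trans eM.
- move=> j k jk g [f [m [y [sf km fy fm gE]]]]; exists f, m, y; split => //.
  by apply: le_trans km; rewrite ler_nat.
- move=> g l gT lE ml lM iW Wa.
  have lae := tall_root_limit g l gT ml lE.
  (* The bound on l holds almost everywhere; l' satisfies it everywhere. *)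
  pose l' x := Num.min (l x) (expR (- 2^-1))%R.
  have ml' : measurable_fun setT l' by exact: measurable_minr.
  have mW u : measurable_fun setT u -> measurable_fun setT (weighted_entropy p (fun=> 1%R) u).
    move=> mu; apply: emeasurable_funM; first exact/measurable_EFinP.
    by apply: measurableT_comp => //; apply: measurable_lne_EFin; exact: measurable_funM.
  have ge_half x : (2^-1)%:E * (p x)%:E <= weighted_entropy p (fun=> 1%R) l' x.
    rewrite /weighted_entropy mulr1 muleC lee_wpmul2l ?lee_fin//.
    have l'0 : (0 <= l' x)%R by rewrite le_min expR_ge0 andbT; case/andP: (lM x).
    move: l'0; rewrite le_eqVlt => /orP[/eqP <-|l'0]; first by rewrite lne0 leey.
    rewrite lne_EFin// -EFinN lee_fin -[leLHS]opprK lerN2 -ler_expR lnK//.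
    by rewrite /l' ge_min lexx orbT.
  suff : (2^-1 : R)%R%:E <= \int[leb R d]_x weighted_entropy p (fun=> 1%R) l x.
    move=> /le_trans/(_ Wa); rewrite lee_fin; lra.
  have mWl := mW l ml; have mWl' := mW l' ml'.
  rewrite (ae_eq_integral (weighted_entropy p (fun=> 1%R) l'))//; last first.
    apply: filterS lae => x lx _; rewrite /weighted_entropy /l'.
    by rewrite (min_idPl lx).
  rewrite -[X in X <= _]mule1 -p1 -ge0_integralZl//.
  + apply: ge0_le_integral => //.
    * by move=> x _; rewrite mule_ge0 ?lee_fin.
    * by apply: emeasurable_funM => //; exact/measurable_EFinP.
  + exact/measurable_EFinP.
  + by move=> x _; rewrite lee_fin.
exists k => P iidP d0; apply: filterS (Hk P iidP d0) => x; apply: filterS => t Ht g gT.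
have := Ht g gT; rewrite (eq_bigr (fun s => g (x s)))//.
by move=> s _; rewrite mulr1.
Qed.

End tall.

(** * All log-concave subdensities *)

Section all_subdensities.
Local Open Scope ereal_scope.
Context {R : realType} {d : nat} (p : 'rV[R]_d -> R) (D1p : D1 R d p).

Lemma subdensity_min (f : 'rV[R]_d -> R) (c : R) : (0 <= c)%R -> subdensity f ->
  subdensity (fun x => Num.min (f x) c).
Proof.
move=> c0 [cf mf f1]; have [f0 _] := cf; split; first exact: logconcave_min.
  exact: measurable_minr.
apply: le_trans f1; apply: ge0_le_integral => //.
- by move=> x _; rewrite lee_fin le_min f0.
- by apply/measurable_EFinP; exact: measurable_minr.
- exact/measurable_EFinP.
- by move=> x _; rewrite lee_fin ge_min lexx.
Qed.

(** Truncating [f] from above does not change the product as long as the values at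
    the sample points are kept.  If these are at most [M], this reduces to the
    bounded case.  Otherwise truncate at the largest of them, [expR m], so that
    the maximum is attained: the product of the values of [f] is then at most
    [expR (- m / 4)] per observation, and that of the inverses of [p] at most
    [expR K].  The threshold for [m] is chosen such that [K - m / 4 <= - a]. *)
Theorem subdensity_likelihood_bound (a : R) : (forall l, L R d l -> a%:E < KL p l) ->
  forall P : probability (sample_path R d) R, iid_law p P -> forall d0 : nat,
  {ae P, forall x : sample_path R d, \forall t \near \oo, forall f, subdensity f ->
    (\prod_(d0 <= s < t) (f (x s) * (p (x s))^-1) <= expR (- a * (t%:R - d0%:R)))%R}.
Proof.
move=> aKL P iidP d0; have [Dp _ _] := D1p; have [mp p0 p1] := Dp.
have [lam lam0 plam] := negative_moment p D1p.
have mv : measurable_fun setT (fun x => (p x)^-1)%R by exact: measurable_inv_ge0.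
have v0 x : (0 <= (p x)^-1)%R by rewrite invr_ge0.
pose I := \int[leb R d]_x (p x * (p x)^-1 `^ lam)%:E.
have I0 : 0 <= I.
  by apply: integral_ge0 => x _; rewrite lee_fin mulr_ge0// powR_ge0.
have IE : I = (fine I)%:E by rewrite fineK// ge0_fin_numE.
(* The product of the inverses of p grows at most like expR (K t): the moment of
   order lam is below expR (lam K). *)
pose K := (fine I / lam)%R.
have IK : I < (expR (- lam * - K))%:E.
  rewrite IE lte_fin mulrNN /K mulrC divfK ?gt_eqF//.
  by apply: lt_le_trans (expR_ge1Dx _); rewrite ltrDr.
have invp := iid_chernoff p Dp P iidP _ lam (- K)%R d0 mv v0 lam0 IK.
have [k tallk] := @tall_root_bound R d p Dp.
pose m0 := Num.max k.+1%:R (4 * (K + a))%R.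
pose M := (Num.truncn (expR m0)).+1.
have m0M : (expR m0 <= M%:R)%R by apply/ltW/truncnS_gt.
have bdd := bounded_subdensity_bound p Dp M lam a lam0 plam aKL P iidP d0.
apply: filterS3 invp (tallk P iidP d0) bdd => x Hp Htall Hbdd.
have td0 : \forall t \near \oo, (d0 <= t)%N by exists d0.
near=> t => f sf; have [[f0 _] _ _] := sf.
have dt : (d0 <= t)%N by near: t.
have [fM|/existsNP[s /not_implyP[sdt /negP]]] :=
    pselect (forall s, (d0 <= s < t)%N -> (f (x s) <= M%:R)%R).
  rewrite (eq_big_nat _ _ (F2 := fun s => Num.min (f (x s)) M%:R * (p (x s))^-1)%R).
    have Hb : forall g, subdensity g -> (forall y, (g y <= M%:R)%R) ->
      (\prod_(d0 <= s < t) (g (x s) * (p (x s))^-1) <= expR (- a * (t%:R - d0%:R)))%R.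
      by near: t.
    apply: (Hb (fun y => Num.min (f y) M%:R)); first exact: subdensity_min.
    by move=> y; rewrite ge_min lexx orbT.
  by move=> s sdt; rewrite (min_idPl (fM s sdt)).
rewrite -ltNge => Mf.
have [i idt fi] := @exists_argmax R (f \o x) d0 t ltac:(lia).
have fxi : (expR m0 < f (x i))%R.
  by apply: le_lt_trans m0M _; apply: lt_le_trans Mf _; exact: fi.
have fxi0 : (0 < f (x i))%R by apply: lt_trans fxi; exact: expR_gt0.
pose m := ln (f (x i)).
have mE : expR m = f (x i) by rewrite lnK.
have m0m : (m0 < m)%R by rewrite -ltr_expR mE.
have m_gt0 : (0 < m)%R.
  by apply: lt_trans m0m; rewrite lt_max ltr0n.
pose g y := (Num.min (f y) (expR m) `^ m^-1)%R.
have tg : tall_root k g.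
  exists (fun y => Num.min (f y) (expR m)), m, (x i); split => //.
  - by apply: subdensity_min => //; exact: expR_ge0.
  - by apply: ltW; apply: le_lt_trans m0m; rewrite le_max lexx.
  - by rewrite mE minxx.
  - by move=> y; rewrite ge_min lexx orbT.
have gf s' : (d0 <= s' < t)%N -> (g (x s') `^ m = f (x s'))%R.
  move=> sdt'; rewrite /g -powRrM mulVf ?gt_eqF// mE (min_idPl (fi s' sdt')).
  by rewrite powRr1//; exact: f0.
have prod_g : (\prod_(d0 <= s < t) g (x s) <= expR (- 4^-1 * (t%:R - d0%:R)))%R.
  suff : forall g, tall_root k g ->
    (\prod_(d0 <= s < t) g (x s) <= expR (- 4^-1 * (t%:R - d0%:R)))%R by exact.
  by near: t.
have g0 y : (0 <= g y)%R by exact: powR_ge0.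
have n0 : (0 <= t%:R - d0%:R :> R)%R by rewrite subr_ge0 ler_nat.
have prod_f : (\prod_(d0 <= s < t) f (x s) <= expR (- (K + a) * (t%:R - d0%:R)))%R.
  rewrite (eq_big_nat _ _ (F2 := fun s => g (x s) `^ m)%R); last by move=> s' /gf.
  rewrite -powR_prod//.
  apply: (@le_trans _ _ (expR (- 4^-1 * (t%:R - d0%:R)) `^ m)%R).
    apply: ge0_ler_powR; rewrite ?nnegrE ?expR_ge0 ?(ltW m_gt0)//.
    exact: prodr_ge0.
  rewrite /powR gt_eqF ?expR_gt0// expRK ler_expR mulrA ler_wpM2r//.
  have : (4 * (K + a) <= m)%R.
    by apply: ltW; apply: le_lt_trans m0m; rewrite le_max lexx orbT.
  lra.
have prod_p : (\prod_(d0 <= s < t) (p (x s))^-1 <= expR (K * (t%:R - d0%:R)))%R.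
  have : (\prod_(d0 <= s < t) (p (x s))^-1 <= expR (- - K * (t%:R - d0%:R)))%R by near: t.
  by rewrite opprK.
rewrite big_split/=.
have -> : (expR (- a * (t%:R - d0%:R)) =
    expR (- (K + a) * (t%:R - d0%:R)) * expR (K * (t%:R - d0%:R)))%R.
  by rewrite -expRD; congr expR; ring.
by apply: ler_pM => //; apply: prodr_ge0.
Unshelve. all: by end_near. Qed.

End all_subdensities.

(** * Hellinger distance and divergence *)

Section hellinger.
Local Open Scope ereal_scope.
Context {R : realType} {d : nat}.

Variables (p l : 'rV[R]_d -> R) (Dp : D R d p) (Dl : D R d l).

Let delta x : R := (Num.sqrt (p x) - Num.sqrt (l x))%R.

Lemma measurable_sqrt_density q : D R d q -> measurable_fun setT (fun x => Num.sqrt (q x)).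
Proof.
move=> [mq _ _]; apply: (measurableT_comp _ mq); apply: continuous_measurable_fun.
exact: sqrt_continuous.
Qed.

Let mdelta : measurable_fun setT delta.
Proof. by apply: measurable_funB; exact: measurable_sqrt_density. Qed.

Let delta2_le x : (delta x ^+ 2 <= p x + l x)%R.
Proof.
have [_ p0 _] := Dp; have [_ l0 _] := Dl.
have := mulr_ge0 (sqrtr_ge0 (p x)) (sqrtr_ge0 (l x)).
by move: (sqr_sqrtr (p0 x)) (sqr_sqrtr (l0 x)); rewrite /delta; nra.
Qed.

Lemma hellinger_sqr : (hellinger p l ^+ 2)%:E = \int[leb R d]_x (delta x ^+ 2)%:E.
Proof.
have [mp p0 p1] := Dp; have [ml l0 l1] := Dl.
have I0 : 0 <= \int[leb R d]_x (delta x ^+ 2)%:E.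
  by apply: integral_ge0 => x _; rewrite lee_fin sqr_ge0.
have IE : \int[leb R d]_x (delta x ^+ 2)%:E =
    (fine (\int[leb R d]_x (delta x ^+ 2)%:E))%:E.
  rewrite fineK// ge0_fin_numE//; apply: (@le_lt_trans _ _ (1 + 1)); last exact: ltry.
  rewrite -{1}p1 -l1 -ge0_integralD//.
  - apply: ge0_le_integral => //.
    + by move=> x _; rewrite lee_fin sqr_ge0.
    + by apply/measurable_EFinP; exact: measurable_funX.
    + by apply: emeasurable_funD; exact/measurable_EFinP.
    + by move=> x _; rewrite -EFinD lee_fin.
  - by move=> x _; rewrite lee_fin.
  - exact/measurable_EFinP.
  - by move=> x _; rewrite lee_fin.
  - exact/measurable_EFinP.
rewrite /hellinger unlock.
rewrite (eq_integral (fun x => (delta x ^+ 2)%:E)); last first.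
  by move=> x _; rewrite /= powR_mulrn// real_normK// num_real.
rewrite IE poweR_EFin/= powR12_sqrt ?fine_ge0// sqr_sqrtr ?fine_ge0//.
Qed.

Lemma hellinger_eq0 : hellinger p l = 0%R -> {ae leb R d, forall x, l x = p x}.
Proof.
have [mp p0 p1] := Dp; have [ml l0 l1] := Dl.
move=> h0; have := hellinger_sqr; rewrite h0 expr0n/= => /esym I0.
have : \int[leb R d]_x `|(delta x ^+ 2)%:E| = 0.
  rewrite (eq_integral (fun x => (delta x ^+ 2)%:E))// => x _.
  by rewrite gee0_abs ?lee_fin ?sqr_ge0.
have md2 : measurable_fun setT (fun x => (delta x ^+ 2)%:E).
  by apply/measurable_EFinP; exact: measurable_funX.
move/(ae_eq_integral_abs _ measurableT md2); apply: filterS => x /(_ Logic.I)[] /eqP.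
rewrite sqrf_eq0 subr_eq0 => /eqP e.
by rewrite -(sqr_sqrtr (l0 x)) -e sqr_sqrtr.
Qed.

(** The inequality [ln u <= u - 1] at the square root of [l / p] gives
    [(sqrt p - sqrt l) ^ 2 + (p - l) <= p * ln (p / l)], and the integral of
    [p - l] is zero. *)
Lemma hellinger_le_KL : (hellinger p l ^+ 2)%:E <= KL p l.
Proof.
have [mp p0 p1] := Dp; have [ml l0 l1] := Dl.
have E (q : 'rV[R]_d -> R) : D R d q -> (leb R d).-integrable setT (fun x => (q x)%:E).
  exact: integrable_density.
have id2 : (leb R d).-integrable setT (fun x => (delta x ^+ 2)%:E).
  apply/integrableP; split; first by apply/measurable_EFinP; exact: measurable_funX.
  rewrite (eq_integral (fun x => (delta x ^+ 2)%:E)) -?hellinger_sqr ?ltry// => x _.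
  by rewrite gee0_abs// lee_fin sqr_ge0.
have <- : \int[leb R d]_x ((delta x ^+ 2)%:E + ((p x)%:E - (l x)%:E)) =
    (hellinger p l ^+ 2)%:E.
  rewrite integralD//; last by apply: integrableB => //; exact: E.
  rewrite integralB//; [|exact: E|exact: E].
  by rewrite p1 l1 -hellinger_sqr subee// adde0.
rewrite /KL; apply: integral_mono.
- apply: emeasurable_funD; first by apply/measurable_EFinP; exact: measurable_funX.
  by apply: emeasurable_funB; exact/measurable_EFinP.
- apply: emeasurable_funM; first exact/measurable_EFinP.
  by apply: emeasurable_funB; exact: measurable_lne_EFin.
move=> x; rewrite /delta.
have := p0 x; rewrite le_eqVlt => /orP[/eqP <-|px].
  rewrite mul0e sqrtr0 sub0r sqrrN sqr_sqrtr// -!EFinB -!EFinD lee_fin; lra.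
have := l0 x; rewrite le_eqVlt => /orP[/eqP <-|lx].
  by rewrite lne0 lne_EFin//= gt0_muley ?lte_fin// leey.
rewrite !lne_EFin// -!EFinB -EFinM -EFinD lee_fin.
set u := Num.sqrt (p x); set w := Num.sqrt (l x).
have u0 : (0 < u)%R by rewrite sqrtr_gt0.
have w0 : (0 < w)%R by rewrite sqrtr_gt0.
have pE : p x = (u ^+ 2)%R by rewrite sqr_sqrtr.
have lE : l x = (w ^+ 2)%R by rewrite sqr_sqrtr.
have lnwu : (ln w - ln u <= w / u - 1)%R.
  rewrite -ln_div ?posrE//; have := @le_ln1Dx R (w / u - 1).
  rewrite (addrC 1%R) subrK => H; apply: H; rewrite ltrBDr addNr; exact: divr_gt0.
have key : (u ^+ 2 * (ln w - ln u) <= u * w - u ^+ 2)%R.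
  have := ler_wpM2l (ltW (exprn_gt0 2 u0)) lnwu.
  have -> : (u ^+ 2 * (w / u - 1) = u * w - u ^+ 2)%R by field; rewrite gt_eqF.
  exact.
rewrite pE lE !lnXn//; clearbody u w.
by move: (ln u) (ln w) key => U W; lra.
Qed.

End hellinger.

(** * Maximum likelihood and regret *)

Section mle.
Context {R : realType} {d : nat}.

(** The estimate does not vanish at the sample points because the Gaussian
    density has a larger likelihood than a function that does. *)
Lemma mleP t (xs : t.-tuple 'rV[R]_d) :
  subdensity (mle xs) /\ forall s : 'I_t, 0 < mle xs (tnth xs s).
Proof.
rewrite /mle; case: xgetP => [f _ [[Df cf] fmax]|_]; last first.
  split; last by move=> s; exact: gaussian_density_gt0.
  have [mg _ g1] := @gaussian_density_D R d.
  by split => //; [exact: logconcave_gaussian_density|rewrite g1].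
have [mf f0 f1] := Df; split; first by split => //; [exact/logconcave_funP|rewrite f1].
move=> s; rewrite ltNge; apply/negP => fs.
have := fmax (@gaussian_density R d).
have : log_likelihood f xs = -oo%E.
  apply/esum_eqNyP; exists s; rewrite mem_index_enum; split=> //.
  by rewrite /lne fs.
move=> -> H; have /H : log_concave_density R d (@gaussian_density R d).
  split; first exact: gaussian_density_D.
  exact/logconcave_funP/logconcave_gaussian_density.
rewrite leeNy_eq => /eqP /esum_eqNyP[s' [_ _ /lne_eqNy]].
by rewrite leNgt gaussian_density_gt0.
Qed.

End mle.

Section regret.
Local Open Scope ereal_scope.
Context {R : realType} {d : nat} (E : forall t, t.-tuple 'rV[R]_d -> 'rV[R]_d -> R).
Variables (p : 'rV[R]_d -> R) (x : sample_path R d) (h c c' : R).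
Let q s := E s (sample_prefix s x) (x s).
Hypotheses (q0 : forall s, (0 <= q s)%R) (px : forall s, (0 < p (x s))%R)
  (h0 : (0 < h)%R) (cc' : (c < c')%R)
  (rho : limn_esup (fun t => regret E p t x * ((t%:R * h)^-1)%:E) <= c%:E).

Let eventually_regret : \forall t \near \oo, regret E p t x * ((t%:R * h)^-1)%:E < c'%:E.
Proof.
have : (- c'%:E < limn_einf (fun t => - (regret E p t x * ((t%:R * h)^-1)%:E))).
  rewrite /limn_einf lteN2.
  under eq_fun do rewrite oppeK.
  by apply: le_lt_trans rho _; rewrite lte_fin.
by move/limn_einf_gt; apply: filterS => t; rewrite lteN2.
Qed.

(** A prediction equal to zero at an observation makes the regret infinite from
    then on. *)
Lemma prediction_gt0 s : (0 < q s)%R.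
Proof.
rewrite lt_neqAle q0 andbT; apply/eqP => qs.
have [N _ HN] := eventually_regret.
pose t := maxn N s.+1.
have := HN t (leq_maxl _ _).
have -> : regret E p t x = +oo.
  apply/esum_eqyP => [i _|].
    rewrite lne_EFin//; rewrite /lne -/(q i); case: ifPn => _ //.
  exists s; split => //; first by rewrite mem_index_iota; exact: (leq_maxr N s.+1).
  by rewrite lne_EFin// -/(q s) -qs lne0.
rewrite gt0_mulye ?lte_fin ?invr_gt0 ?mulr_gt0 ?ltr0n// ?leq_max ?orbT//.
Qed.

Lemma regret_bound : \forall t \near \oo,
  (\sum_(0 <= s < t) (ln (p (x s)) - ln (q s)) <= c' * (t%:R * h))%R.
Proof.
have t0 : \forall t \near \oo, (0 < t)%N by exists 1%N.
apply: filterS2 t0 eventually_regret => t t0.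
rewrite /regret (eq_bigr (fun s => (ln (p (x s)) - ln (q s))%:E)); last first.
  by move=> s _; rewrite !lne_EFin// prediction_gt0.
rewrite sumEFin -EFinM lte_fin ltr_pdivrMr ?mulr_gt0 ?ltr0n// => /ltW.
exact.
Qed.

End regret.

Lemma iid_density_gt0 {R : realType} {d : nat} (p : 'rV[R]_d -> R)
    (P : probability (sample_path R d) R) : D R d p -> iid_law p P ->
  {ae P, forall x : sample_path R d, forall s, 0 < p (x s)}.
Proof.
move=> [mp p0 p1] iidP; apply/ae_foralln => s.
pose Z := [set y | p y <= 0].
have mZ : measurable Z.
  rewrite (_ : Z = p @^-1` `]-oo, 0]); last first.
    by apply/seteqP; split => y; rewrite /Z /= in_itv.
  by rewrite -[X in measurable X]setTI; exact: mp.
pose B i := if i == s then Z else setT.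
have mB i : measurable (B i) by rewrite /B; case: ifP.
have PB := iidP s.+1 B mB.
have BE : [set x : sample_path R d | forall i, (i < s.+1)%N -> B i (x i)] =
    (fun x : sample_path R d => x s) @^-1` Z.
  apply/seteqP; split => x /= H; first by have := H s (ltnSn s); rewrite /B eqxx.
  by move=> i _; rewrite /B; case: eqP => // ->.
exists [set x : sample_path R d | forall i, (i < s.+1)%N -> B i (x i)]; split.
- by rewrite BE -[X in measurable X]setTI; exact: measurable_observation.
- transitivity (\prod_(i < s.+1) law p (B i))%E; first exact: PB.
  rewrite big_ord_recr/= /B eqxx (_ : law p Z = 0%E) ?mule0//.
  rewrite /law integral0_eq// => y /= py; congr EFin; apply/le_anti; rewrite py p0//.
- move=> x /= xs i; rewrite ltnS /B => _; case: eqP => // ->.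
  by rewrite /Z/= leNgt; apply/negP.
Qed.

Theorem theorem10 (R : realType) :
  exists c : R, 25%:R^-1 < c /\
  forall (d : nat), (1 <= d)%N ->
  forall (E : forall t, t.-tuple 'rV[R]_d -> 'rV[R]_d -> R),
  sequential_estimator E ->
  forall p : 'rV[R]_d -> R, (Q E c `\` L R d) p ->
    iid_almost_surely p [set x | ULR E t x @[t --> \oo] --> +oo] /\
    forall alpha : R, 0 < alpha < 1 ->
      iid_almost_surely p [set x | (rejection_time E alpha x < +oo)%E].
Proof.
exists 2^-1; split; first by lra.
move=> d d1 E seqE p [[D1p [l [[Ll lmin] Qp]]] pL].
have [Dp _ _] := D1p; have [mp p0 p1] := Dp; have [Dl _] := Ll.
have h0 : 0 < hellinger p l ^+ 2.
  rewrite lt_neqAle sqr_ge0 andbT eq_sym sqrf_eq0; apply/eqP => h0; apply: pL.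
  split => //; have [_ [f [fl fle]]] := Ll; exists f; split => //.
  by apply: filterS2 fle (hellinger_eq0 p l Dp Dl h0) => x -> ->.
set h := hellinger p l ^+ 2 in h0.
(* As 1/2 < 5/8 < 3/4, the regret is eventually at most 5/8 h per observation,
   the likelihood ratio decreases at rate 3/4 h, and 1/8 h is left for the growth
   of ULR. *)
pose a := 3 / 4 * h.
have aKL l' : L R d l' -> (a%:E < KL p l')%E.
  move=> Ll'; apply: lt_le_trans (lmin l' Ll').
  by apply: lt_le_trans (hellinger_le_KL p l Dp Dl); rewrite lte_fin -/h /a; lra.
have diverges P : iid_law p P -> {ae P, forall x, ULR E t x @[t --> \oo] --> +oo}.
  move=> iidP.
  have ppos : {ae P, forall x : sample_path R d, forall s, 0 < p (x s)}.
    exact: iid_density_gt0.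
  apply: filterS3 ppos (Qp P iidP) (subdensity_likelihood_bound p D1p a aKL P iidP d).
  move=> x px rho Hbound.
  pose q s := E s (sample_prefix s x) (x s).
  have q0 s : 0 <= q s by have [_ /(_ (sample_prefix s x))[_ + _]] := seqE s; exact.
  have cc' : 2^-1 < 5 / 8 :> R by lra.
  have qpos := prediction_gt0 E p x h 2^-1 (5 / 8) q0 px h0 cc' rho.
  have rhob := regret_bound E p x h 2^-1 (5 / 8) q0 px h0 cc' rho.
  pose C := \sum_(0 <= s < d) (ln (p (x s)) - ln (q s)).
  have lower : \forall t \near \oo, C - a * d%:R + h / 8 * t%:R <= ULR E t x.
    have td : \forall t \near \oo, (d < t)%N by exists d.+1.
    apply: filterS3 td rhob Hbound => t dt Hrho Hb.
    have [sf fpos] := mleP t (sample_prefix t x).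
    have {}Hb := Hb _ sf.
    have fpos' s : (d <= s < t)%N -> 0 < mle (sample_prefix t x) (x s).
      move=> /andP[_ st]; have := fpos (Ordinal st).
      by rewrite tnth_mktuple.
    have -> : ULR E t x = \prod_(d <= s < t) (q s / mle (sample_prefix t x) (x s)).
      by rewrite /ULR leqNgt dt.
    set F := fun s => mle (sample_prefix t x) (x s) in fpos' Hb *.
    have Yposs : 0 < \prod_(d <= s < t) (F s * (p (x s))^-1).
      rewrite big_nat_cond; apply: prodr_gt0 => s /andP[sdt _].
      by rewrite mulr_gt0 ?fpos' ?invr_gt0.
    pose S := \sum_(d <= s < t) (ln (p (x s)) - ln (q s)).
    (* ULR times the likelihood ratio of the estimate to p is the exponential of
       minus the regret since time d, and C is the regret up to time d. *)
    have XY : \prod_(d <= s < t) (q s / F s) * \prod_(d <= s < t) (F s * (p (x s))^-1) =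
        expR (- S).
      rewrite -big_split/= /S -sumrN expR_sum; apply: eq_big_nat => s sdt.
      rewrite mulrA divfK ?gt_eqF ?fpos'//.
      by rewrite opprB expRD expRN !lnK// posrE; [exact: px|exact: qpos].
    have SE : S = \sum_(0 <= s < t) (ln (p (x s)) - ln (q s)) - C.
      by rewrite /S /C (@big_cat_nat _ _ _ d 0 t)//= 1?ltnW// addrAC subrr add0r.
    apply: (@le_trans _ _ (expR (- S) * expR (a * (t%:R - d%:R)))).
      rewrite -expRD; apply: le_trans (expR_ge1Dx _).
      rewrite SE /a; move: Hrho; set Z := \sum_(0 <= s < t) _ => Hrho; lra.
    rewrite -XY -mulrA ler_piMr//.
      rewrite big_nat_cond; apply: prodr_ge0 => s /andP[sdt _].
      by rewrite divr_ge0 ?q0// ltW// fpos'.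
    by rewrite -ler_pdivlMr ?expR_gt0// div1r -expRN -mulNr.
  apply/cvgryPge => A.
  have h8 : 0 < h / 8 by rewrite divr_gt0.
  apply: filterS2 lower (nbhs_infty_ger ((A - (C - a * d%:R)) / (h / 8))) => t Ht tA.
  apply: le_trans Ht; move: tA; rewrite ler_pdivrMr// mulrC; lra.
split; first exact: diverges.
move=> alpha /andP[alpha0 alpha1] P iidP.
apply: filterS (diverges P iidP) => x Rx.
have [N _ HN] := (cvgryPge (ULR E ^~ x)).1 Rx alpha^-1.
apply: (@le_lt_trans _ _ (maxn N 1)%:R%:E); last exact: ltry.
apply: ereal_inf_lbound; exists (maxn N 1) => //=.
by rewrite leq_maxr; split => //; apply: HN => /=; exact: leq_maxl.
Qed.
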